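(* Let $\mathfrak{A}$ be a unital $C^*$-algebra. A spreadable (resp. exchangeable) state $\varphi$ on $\ast_{\mathbb{N}}\mathfrak{A}$ is extreme in $\mathcal{S}^{\mathbb{J}_{\mathbb{N}}}(\ast_{\mathbb{N}}\mathfrak{A})$ (resp. in $\mathcal{S}^{\mathbb{P}_{\mathbb{N}}}(\ast_{\mathbb{N}}\mathfrak{A})$), or equivalently in $\mathcal{S}^\tau(\ast_{\mathbb{N}}\mathfrak{A})$, if and only if the restriction of $\widetilde\varphi$ to the tail algebra $\mathcal{T}_\varphi$ is extreme in $\mathcal{S}_*(\mathcal{T}_\varphi)$ (i.e. a pure and normal state of $\mathcal{T}_\varphi$).
   Context: $\mathbb{N}=\{0,1,2,\dots\}$. $\ast_{\mathbb{N}}\mathfrak{A}$ is the unital free product $C^*$-algebra (units amalgamated) of copies of $\mathfrak{A}$ indexed by $\mathbb{N}$, with canonical unital embeddings $i_j$. For an injective map $f:\mathbb{N}\to\mathbb{N}$, $\alpha_f$ is the unital $*$-endomorphism with $\alpha_f(i_j(a))=i_{f(j)}(a)$; $\tau$ is the shift, $\tau(i_j(a))=i_{j+1}(a)$. $\mathbb{P}_{\mathbb{N}}$ is the group of bijections of $\mathbb{N}$ moving only finitely many points; $\mathbb{J}_{\mathbb{N}}$ is the semigroup of strictly increasing maps $h:\mathbb{N}\to\mathbb{N}$ with $|\mathbb{N}\setminus h(\mathbb{N})|<\infty$. $\mathcal{S}^{\tau}(\ast_{\mathbb{N}}\mathfrak{A})$, $\mathcal{S}^{\mathbb{J}_{\mathbb{N}}}(\ast_{\mathbb{N}}\mathfrak{A})$,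 $\mathcal{S}^{\mathbb{P}_{\mathbb{N}}}(\ast_{\mathbb{N}}\mathfrak{A})$ are the convex sets of states invariant under $\tau$ (stationary), under all $\alpha_h$, $h\in\mathbb{J}_{\mathbb{N}}$ (spreadable), and under all $\alpha_\sigma$, $\sigma\in\mathbb{P}_{\mathbb{N}}$ (exchangeable). $(\pi_\varphi,\mathcal{H}_\varphi,\xi_\varphi)$ is the GNS triple of $\varphi$; $\mathcal{T}_\varphi:=\bigcap_{n\in\mathbb{N}}\{\pi_\varphi(i_k(\mathfrak{A})):k\ge n\}''$ is the tail algebra; $\widetilde\varphi(T):=\langle T\xi_\varphi,\xi_\varphi\rangle$ for $T\in\mathcal{B}(\mathcal{H}_\varphi)$. $\mathcal{S}_*(\mathcal{R})$ is the convex set of normal states of a von Neumann algebra $\mathcal{R}$. *)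

(* Defs.v *)
From HB Require Import structures.
From mathcomp Require Import all_boot all_order all_algebra.
From mathcomp Require Import sesquilinear.
From mathcomp Require Import complex.
From mathcomp Require Import all_classical all_reals all_analysis.

Set Implicit Arguments.
Unset Strict Implicit.
Unset Printing Implicit Defensive.

Import Order.TTheory GRing.Theory Num.Theory Num.Def.
Import numFieldNormedType.Exports.

Local Open Scope classical_set_scope.
Local Open Scope ring_scope.
Local Open Scope complex_scope.

Reserved Notation "x ** y" (at level 40, left associativity).

(* Unital C*-algebras.  The product and the unit are fields of the mixin
   because the hierarchy has no join of rings and normed modules.  Norms over
   [R[i]] take their values in [R[i]].  The zero algebra is not excluded: it
   carries no state. *)
HB.mixin Record isCStar (R : realType) A of CompleteNormedModule R[i] A := {
  cmul : A -> A -> A ;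
  cone : A ;
  star : A -> A ;
  cmulA : associative cmul ;
  cmul1l : left_id cone cmul ;
  cmul1r : right_id cone cmul ;
  cmulDl : left_distributive cmul +%R ;
  cmulDr : right_distributive cmul +%R ;
  cmulZl : forall (c : R[i]) x y, cmul (c *: x) y = c *: cmul x y ;
  cmulZr : forall (c : R[i]) x y, cmul x (c *: y) = c *: cmul x y ;
  starK : involutive star ;
  starD : {morph star : x y / x + y} ;
  starZ : forall (c : R[i]) x, star (c *: x) = conjC c *: star x ;
  starM : forall x y, star (cmul x y) = cmul (star y) (star x) ;
  cstar_normM : forall x y : A, `|cmul x y| <= `|x| * `|y| ;
  cstar_norm : forall x : A, `|cmul (star x) x| = `|x| ^+ 2
}.

#[short(type="cstarType")]
HB.structure Definition CStar (R : realType) :=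
  {A of isCStar R A & CompleteNormedModule R[i] A}.

Notation "x ** y" := (cmul x y) : ring_scope.

(* [hdot] is linear in its first argument and antilinear in the second. *)
HB.mixin Record isHilbert (R : realType) H of CompleteNormedModule R[i] H := {
  hdot : {dot H for (@conjC R[i])} ;
  hdot_norm : forall x : H, `|x| ^+ 2 = hdot x x
}.

#[short(type="hilbertType")]
HB.structure Definition Hilbert (R : realType) :=
  {H of isHilbert R H & CompleteNormedModule R[i] H}.

Section FreeProduct.
Variable R : realType.
Implicit Types A B D : cstarType R.

Record starHom A B := StarHom {
  hom_fun :> {linear A -> B} ;
  hom1 : hom_fun cone = cone ;
  homM : forall x y, hom_fun (x ** y) = hom_fun x ** hom_fun y ;
  homS : forall x, hom_fun (star x) = star (hom_fun x)
}.

Definition cstar_subalgebra B (S : set B) : Prop :=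
  [/\ closed S,
      S cone,
      forall (c : R[i]) x y, S x -> S y -> S (c *: x + y),
      forall x y, S x -> S y -> S (x ** y)
    & forall x, S x -> S (star x)].

(* The unital free product of copies of [A] indexed by [nat]: the universal
   unital C*-algebra generated by these copies.  Uniqueness of [fp_lift] follows
   from [fp_gen]. *)
Record freeProduct A := FreeProduct {
  fp_alg :> cstarType R ;
  fp_in : nat -> starHom A fp_alg ;
  fp_gen : forall S : set fp_alg, cstar_subalgebra S ->
    (forall j a, S (fp_in j a)) -> S = setT ;
  fp_lift : forall D, (nat -> starHom A D) -> starHom fp_alg D ;
  fp_liftE : forall D (g : nat -> starHom A D) j a,
    fp_lift g (fp_in j a) = g j a
}.

Definition fp_endo A (F : freeProduct A) (f : nat -> nat) : starHom F F :=
  fp_lift F (fun j => fp_in F (f j)).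

Definition is_state B (phi : B -> R[i]) : Prop :=
  [/\ scalar phi, forall x, 0 <= phi (star x ** x) & phi cone = 1].

Definition invariant_states A (F : freeProduct A) (G : set (nat -> nat)) :
    set (F -> R[i]) :=
  [set phi | is_state phi /\
             forall f, G f -> forall x, phi (fp_endo F f x) = phi x].
Arguments invariant_states {A} F G.

Definition finite_permutations : set (nat -> nat) :=
  [set s : nat -> nat | bijective s /\ finite_set [set n | s n <> n]].

Definition cofinite_increasing : set (nat -> nat) :=
  [set h : nat -> nat | {homo h : m n / (m < n)%N} /\ finite_set (~` range h)].

Definition stationary_states A (F : freeProduct A) :=
  invariant_states F [set succn].

Definition spreadable_states A (F : freeProduct A) :=
  invariant_states F cofinite_increasing.

Definition exchangeable_states A (F : freeProduct A) :=
  invariant_states F finite_permutations.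

Definition extreme_point (T : Type) (S : set (T -> R[i])) (phi : T -> R[i]) :
    Prop :=
  S phi /\
  forall (psi1 psi2 : T -> R[i]) (t : R), S psi1 -> S psi2 -> 0 < t < 1 ->
    phi = (fun x => t%:C * psi1 x + (1 - t)%:C * psi2 x) ->
    psi1 = phi /\ psi2 = phi.

End FreeProduct.

Arguments invariant_states {R A} F G.
Arguments stationary_states {R A} F.
Arguments spreadable_states {R A} F.
Arguments exchangeable_states {R A} F.

Section Operators.
Variables (R : realType) (H : hilbertType R).

Definition bounded_op : set (H -> H) :=
  [set T | linear T /\ exists M : R, forall x, `|T x| <= M%:C * `|x|].

Definition commutant (S : set (H -> H)) : set (H -> H) :=
  [set T | bounded_op T /\ forall X, S X -> T \o X = X \o T].

Definition op_le (X Y : H -> H) : Prop :=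
  forall x, hdot (X x) x <= hdot (Y x) x.

Definition self_adjoint (X : H -> H) : Prop :=
  forall x y, hdot (X x) y = hdot x (X y).

(* In what follows [M] is meant to be a von Neumann algebra on [H]; its
   elements form the type [set_type M], to which [M] coerces. *)
Definition vn_states (M : set (H -> H)) : set (M -> R[i]) :=
  [set w | [/\ forall (c : R[i]) (X Y Z : M),
                 val Z = c \*: val X \+ val Y -> w Z = c * w X + w Y,
               forall X : M, op_le (cst 0) (val X) -> 0 <= w X
             & forall X : M, val X = idfun -> w X = 1]].
Arguments vn_states : clear implicits.

Definition op_sup (M : set (H -> H)) (E : set M) (X : M) : Prop :=
  (forall Y, E Y -> op_le (val Y) (val X)) /\
  (forall Z : M, (forall Y, E Y -> op_le (val Y) (val Z)) ->
     op_le (val X) (val Z)).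

(* Increasing nets are represented by their ranges. *)
Definition normal (M : set (H -> H)) (w : M -> R[i]) : Prop :=
  forall (E : set M) (X : M),
    E !=set0 ->
    (forall Y, E Y -> self_adjoint (val Y)) ->
    (forall Y1 Y2, E Y1 -> E Y2 ->
       exists Y3, [/\ E Y3, op_le (val Y1) (val Y3) & op_le (val Y2) (val Y3)]) ->
    op_sup E X ->
    supremums (w @` E) (w X).

Definition normal_states (M : set (H -> H)) : set (M -> R[i]) :=
  [set w | vn_states M w /\ normal w].

Definition pure_state (M : set (H -> H)) (w : M -> R[i]) : Prop :=
  extreme_point (vn_states M) w.

Definition vector_functional (xi : H) (T : H -> H) : R[i] := hdot (T xi) xi.

Definition restriction (M : set (H -> H)) (w : (H -> H) -> R[i]) : M -> R[i] :=
  fun T => w (val T).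

Definition gns_triple (B : cstarType R) (phi : B -> R[i]) (rho : B -> H -> H)
    (xi : H) : Prop :=
  [/\ forall a, bounded_op (rho a),
      [/\ forall (c : R[i]) a b, rho (c *: a + b) = c \*: rho a \+ rho b,
          forall a b, rho (a ** b) = rho a \o rho b,
          rho cone = idfun
        & forall a x y, hdot (rho a x) y = hdot x (rho (star a) y)],
      closure (range (rho ^~ xi)) = setT
    & forall a, phi a = vector_functional xi (rho a)].

Definition tail_algebra (A : cstarType R) (F : freeProduct A)
    (rho : F -> H -> H) : set (H -> H) :=
  \bigcap_(n in [set: nat])
    commutant (commutant
      [set T | exists k a, (n <= k)%N /\ T = rho (fp_in F k a)]).

End Operators.

Arguments vn_states {R H} M.
Arguments normal_states {R H} M.

(* Main.v *)
Require Import Defs.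
From mathcomp Require Import all_boot all_order all_algebra.
From mathcomp Require Import sesquilinear complex.
From mathcomp Require Import all_classical all_reals all_analysis.
From mathcomp Require Import ring lra zify.
Set Implicit Arguments.
Unset Strict Implicit.
Unset Printing Implicit Defensive.
Import Order.TTheory GRing.Theory Num.Theory Num.Def.
Import numFieldNormedType.Exports.
Local Open Scope classical_set_scope.
Local Open Scope ring_scope.
Local Open Scope complex_scope.
Local Notation Re := complex.Re.
Local Notation Im := complex.Im.

(** Let [phi] be a state that is spreadable or exchangeable.  Both symmetries
    contain, at least on elements that involve finitely many copies, the partial
    shifts [act_from k succn], which fix the first [k] copies and move the others
    one place up ([spreadable_shift_invariant], [exchangeable_shift_invariant]).
    If [y] and [z] involve the first [k] copies only, invariance under these maps
    makes [phi (z^* tau^m(x) y)] independent of [m >= k].  Hence the operators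
    [rho (tau^m x)] converge weakly, and their limit [E x] lies in the tail
    algebra [T] ([weak_limit_exists], [weak_limit_tail]).  The map [E] is linear,
    unital and positive, it satisfies [hdot (E x xi) xi = phi x], and it is
    invariant under the whole symmetry group or semigroup, because this set is
    stable under the operation [act_from k] ([expectation_invariant]).

    Suppose that [phi] is extreme among the invariant states, and decompose the
    vector state of [T] as a convex combination of [w1] and [w2].  The states
    [w1 \o E] and [w2 \o E] are invariant and their combination is [phi], so both
    equal [phi]: thus [w1] and [w2] agree with the vector state on the range of
    [E].  This determines them on [T].  Being dominated by the vector state, they
    are continuous for the seminorm [nrm (X xi)], and for this seminorm the range
    of [E] is dense in [T] ([expectation_approx]): a vector [X xi] with [X] in the
    tail algebra belongs to the closed span of every tail, so the shift fixes it,
    and since shifts are isometric on [rho F xi], an approximation [rho x xi] of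
    [X xi] yields the approximation [E x xi] of the same quality.

    Conversely, suppose that the vector state is extreme among the normal states
    of [T], and decompose [phi] into stationary states [psi1] and [psi2].  A state
    below a multiple of [phi] is [psi x = hdot (rho x (S xi)) xi] for a positive
    operator [S] commuting with [rho F] ([radon_nikodym]).  The functional
    [X |-> hdot (X (S xi)) xi] on [T] is a state, since the product of two commuting
    positive operators is positive ([positive_op_comm]), and it is normal, since
    it is dominated by the vector state ([dominated_normal]).  By extremality it
    is the vector state.  By stationarity [psi x = psi (tau^m x)], which tends to
    [hdot (E x (S xi)) xi = hdot (E x xi) xi = phi x].

    As stationarity is weaker than either symmetry, the two implications close a
    circle through all the extremality conditions.  That extreme normal states are
    pure is again domination: the components of any convex decomposition of the
    vector state are automatically normal ([extreme_normal_pure]).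

    All continuity comes from the boundedness of positive functionals
    ([functional_square_le]), which makes representations contractive and therefore
    determined by their values on the generators of the free product. *)

(** * Complex numbers, real norms and limits *)

Section Complex.
Variable R : realType.
Implicit Types (z w : R[i]) (r s : R).

Lemma cRe_conj z : Re (conjC z) = Re z.
Proof. by change (conjC z) with (conjc z); case: z. Qed.
Lemma cIm_conj z : Im (conjC z) = - Im z.
Proof. by change (conjC z) with (conjc z); case: z. Qed.
Lemma cReD z w : Re (z + w) = Re z + Re w. Proof. by case: z; case: w. Qed.
Lemma cImD z w : Im (z + w) = Im z + Im w. Proof. by case: z; case: w. Qed.
Lemma cReN z : Re (- z) = - Re z. Proof. by case: z. Qed.
Lemma cImN z : Im (- z) = - Im z. Proof. by case: z. Qed.
Lemma cReM z w : Re (z * w) = Re z * Re w - Im z * Im w.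
Proof. by case: z; case: w. Qed.
Lemma cImM z w : Im (z * w) = Re z * Im w + Im z * Re w.
Proof. by case: z; case: w => a b c d /=; ring. Qed.
Lemma cRe1 : Re (1 : R[i]) = 1. Proof. by []. Qed.
Lemma cIm1 : Im (1 : R[i]) = 0. Proof. by []. Qed.
Lemma cRe0 : Re (0 : R[i]) = 0. Proof. by []. Qed.
Lemma cIm0 : Im (0 : R[i]) = 0. Proof. by []. Qed.

Definition ReImE := (cReD, cImD, cReN, cImN, cReM, cImM, cRe_conj, cIm_conj,
  cRe1, cIm1, cRe0, cIm0).

Lemma complex_eqP z w : Re z = Re w -> Im z = Im w -> z = w.
Proof. by case: z; case: w => a b c d /= -> ->. Qed.

Lemma ge0cP z : 0 <= z <-> Im z = 0 /\ 0 <= Re z.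
Proof. by rewrite lecE /=; split=> [/andP[/eqP-> ->]|[-> ->]] //; rewrite eqxx. Qed.

Lemma lecP z w : z <= w <-> Im w = Im z /\ Re z <= Re w.
Proof. by rewrite lecE; split=> [/andP[/eqP-> ->]|[-> ->]] //; rewrite eqxx. Qed.

Lemma conjCr r : conjC r%:C = r%:C. 
Proof. by apply: complex_eqP; rewrite ?cRe_conj ?cIm_conj /= ?oppr0. Qed.

Lemma conjcD z w : conjC (z + w) = conjC z + conjC w.
Proof. exact: rmorphD. Qed.
Lemma conjcM z w : conjC (z * w) = conjC z * conjC w.
Proof. exact: rmorphM. Qed.
Lemma conjcN z : conjC (- z) = - conjC z.
Proof. exact: rmorphN. Qed.
Lemma conjCKc z : conjC (conjC z) = z.
Proof. by apply: complex_eqP; rewrite !ReImE ?opprK. Qed.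
Definition conjcE := (conjcD, conjcM, conjcN, conjCKc).

(** The discriminant criterion, for a nonnegative form on a space spanned by
    two vectors, of which [a], [b], [b'], [d] are the coefficients.  It is the
    common source of the Cauchy-Schwarz inequalities for states and operators. *)
Lemma quadratic_ge0 (a b b' d : R[i]) : 0 <= a ->
  (forall z, 0 <= d + z * b' + conjC z * b + z * conjC z * a) ->
  [/\ b' = conjC b, 0 <= d & Re b ^+ 2 + Im b ^+ 2 <= Re a * Re d].
Proof.
move=> /ge0cP[ia0 ra0] pos.
have /ge0cP[] := pos 0; rewrite !ReImE => id0 rd0.
have /ge0cP[] := pos 1; rewrite !ReImE => i1 _.
have /ge0cP[] := pos 'i; rewrite !ReImE /= => i2 _.
have b'E : b' = conjC b by apply: complex_eqP; rewrite !ReImE; lra.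
split => //; first by apply/ge0cP; split; lra.
set q := _ + _; have q0 : 0 <= q by rewrite /q; nra.
have key s : 0 <= Re d - 2 * s * q + s ^+ 2 * q * Re a.
  have /ge0cP[_] := pos (- s%:C * b); rewrite b'E !ReImE /= ia0.
  by move=> h; rewrite /q; apply: le_trans h _; rewrite le_eqVlt; apply/orP; left; apply/eqP; ring.
have [a0|a0] := eqVneq (Re a) 0.
  rewrite a0 mul0r leNgt; apply/negP => qp.
  have := key ((Re d + 1) / q); rewrite a0 mulr0 addr0.
  have -> : 2 * ((Re d + 1) / q) * q = 2 * (Re d + 1) by field; rewrite gt_eqF.
  lra.
have ap : 0 < Re a by rewrite lt_def a0.
have := key (Re a)^-1.
have -> : Re d - 2 * (Re a)^-1 * q + (Re a)^-1 ^+ 2 * q * Re a = Re d - q / Re a by field.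
by rewrite subr_ge0 ler_pdivrMr // mulrC.
Qed.

End Complex.

Section RealNorm.
Variable R : realType.

(** Norms over [R[i]] are complex numbers on the nonnegative axis; [nrm] is the
    same number in the ordered field [R], where estimates can be carried out. *)
Definition nrm (V : normedZmodType R[i]) (x : V) : R := Re `|x|.

Lemma nrmE (V : normedZmodType R[i]) (x : V) : `|x| = (nrm x)%:C.
Proof.
have /ge0cP[i0 _] := normr_ge0 x.
by apply: complex_eqP; rewrite //= i0.
Qed.

Section Generic.
Variable V : normedZmodType R[i].
Implicit Types x y : V.

Lemma nrm_ge0 x : 0 <= nrm x.
Proof. by have := normr_ge0 x; rewrite nrmE lecR. Qed.

Lemma nrm0 : nrm (0 : V) = 0. Proof. by rewrite /nrm normr0. Qed.

Lemma nrm_eq0 x : nrm x = 0 -> x = 0.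
Proof. by move=> h; apply/eqP; rewrite -normr_eq0 nrmE h. Qed.

Lemma nrmD x y : nrm (x + y) <= nrm x + nrm y.
Proof. by have := ler_normD x y; rewrite !nrmE -rmorphD lecR. Qed.

Lemma nrmN x : nrm (- x) = nrm x. Proof. by rewrite /nrm normrN. Qed.

Lemma nrmB x y : nrm (x - y) <= nrm x + nrm y.
Proof. by rewrite -(nrmN y) nrmD. Qed.

Lemma nrm_distC x y : nrm (x - y) = nrm (y - x).
Proof. by rewrite -nrmN opprB. Qed.

Lemma nrm_triangle y x z : nrm (x - z) <= nrm (x - y) + nrm (y - z).
Proof. by apply: le_trans (nrmD _ _); rewrite addrA subrK. Qed.

Lemma nrm_le_dist x y : nrm x <= nrm (x - y) + nrm y.
Proof. by apply: le_trans (nrmD _ _); rewrite subrK. Qed.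

Lemma nrm_le_eps (K : R) x : (forall e, 0 < e -> nrm x <= K * e) -> x = 0.
Proof.
move=> h; apply: nrm_eq0; apply/eqP; rewrite eq_le nrm_ge0 andbT.
apply/ler_addgt0Pr => e e0; rewrite add0r.
have K0 : 0 < `|K| + 1 by rewrite ltr_wpDl.
apply: le_trans (h (e / (`|K| + 1)) _) _; first by rewrite divr_gt0.
have := ler_norm K; rewrite mulrA ler_pdivrMr // mulrC; nra.
Qed.

End Generic.

Lemma nrmZ (V : normedModType R[i]) (c : R[i]) (x : V) : nrm (c *: x) = nrm c * nrm x.
Proof. by rewrite /nrm normrZ cReM (nrmE x) /= mulr0 subr0. Qed.

Lemma nrmM (c d : R[i]) : nrm (c * d) = nrm c * nrm d.
Proof. by rewrite /nrm normrM cReM (nrmE c) /= mul0r subr0. Qed.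

Lemma nrm_sqr (c : R[i]) : nrm c ^+ 2 = Re c ^+ 2 + Im c ^+ 2.
Proof. by have := add_Re2_Im2 c; rewrite nrmE -rmorphXn => /complexI. Qed.

Lemma nrm_conj (c : R[i]) : nrm (conjC c) = nrm c.
Proof. by rewrite /nrm; congr Re; exact: normcJ. Qed.

Lemma nrm_real (r : R) : nrm r%:C = `|r|.
Proof.
apply/eqP; rewrite -(eqrXn2 (n := 2)) ?nrm_ge0 // nrm_sqr /= expr0n addr0.
by rewrite real_normK ?num_real.
Qed.

Lemma Re_le_nrm (c : R[i]) : `|Re c| <= nrm c.
Proof.
rewrite -(ler_pXn2r (n := 2)) ?nnegrE ?nrm_ge0 // nrm_sqr real_normK ?num_real //.
by rewrite lerDl sqr_ge0.
Qed.

End RealNorm.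

Section Limits.
Variable R : realType.

(** Defined over [normedZmodType], so that scalars and vectors are covered at
    once. *)
Definition converges (V : normedZmodType R[i]) (a : nat -> V) (l : V) : Prop :=
  forall e : R, 0 < e -> exists n, forall k, (n <= k)%N -> nrm (a k - l) <= e.

Definition cauchy_sequence (V : normedZmodType R[i]) (a : nat -> V) : Prop :=
  forall e : R, 0 < e ->
    exists n, forall k m, (n <= k)%N -> (n <= m)%N -> nrm (a k - a m) <= e.

Section Generic.
Variable V : normedZmodType R[i].
Implicit Types (a b : nat -> V) (l m : V).

Lemma converges_unique a l m : converges a l -> converges a m -> l = m.
Proof.
move=> al am; apply/eqP; rewrite -subr_eq0; apply/eqP.
apply: (@nrm_le_eps _ _ 2) => e e0.
have [n hn] := al _ e0; have [p hp] := am _ e0.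
apply: le_trans (nrm_triangle (a (maxn n p)) _ _) _.
have := hn (maxn n p) (leq_maxl _ _); have := hp (maxn n p) (leq_maxr _ _).
by rewrite (nrm_distC l); lra.
Qed.

Lemma converges_cst l : converges (fun=> l) l.
Proof. by move=> e e0; exists 0%N => k _; rewrite subrr nrm0 ltW. Qed.

Lemma convergesD a b l m : converges a l -> converges b m ->
  converges (fun k => a k + b k) (l + m).
Proof.
move=> al bm e e0; have e20 : 0 < e / 2 by rewrite divr_gt0.
have [n hn] := al _ e20; have [p hp] := bm _ e20.
exists (maxn n p) => k; rewrite geq_max => /andP[nk pk].
rewrite opprD addrACA; apply: le_trans (nrmD _ _) _.
by have := hn k nk; have := hp k pk; lra.
Qed.

Lemma converges_le a l (K : R) N :
  (forall k, (N <= k)%N -> nrm (a k) <= K) -> converges a l -> nrm l <= K.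
Proof.
move=> aK al; apply/ler_addgt0Pr => e e0; have [n hn] := al _ e0.
have := aK _ (leq_maxl N n); have := hn _ (leq_maxr N n).
have := nrm_triangle (a (maxn N n)) l 0; rewrite !subr0 nrm_distC; lra.
Qed.

Lemma converges_shift a l : converges a l -> converges (fun k => a k.+1) l.
Proof. by move=> al e /al[n hn]; exists n => k nk; apply: hn; rewrite ltnW. Qed.

Lemma converges_ext a b l N : (forall k, (N <= k)%N -> a k = b k) ->
  converges a l -> converges b l.
Proof.
move=> ab al e /al[n hn]; exists (maxn N n) => k; rewrite geq_max => /andP[Nk nk].
by rewrite -ab // hn.
Qed.

Lemma convergesB0 a b l : converges a l -> converges (fun k => b k - a k) 0 ->
  converges b l.
Proof.
move=> al /(convergesD al); rewrite addr0; apply: (@converges_ext _ _ _ 0) => k _.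
by rewrite addrC subrK.
Qed.

End Generic.

Lemma converges_lip (V W : normedZmodType R[i]) (f : V -> W) (K : R) a l :
  (forall x y, nrm (f x - f y) <= K * nrm (x - y)) ->
  converges a l -> converges (f \o a) (f l).
Proof.
move=> fK al e e0.
have K0 : 0 < `|K| + 1 by rewrite ltr_wpDl.
have [n hn] := al (e / (`|K| + 1)) (divr_gt0 e0 K0); exists n => k /hn hk.
apply: le_trans (fK _ _) _; apply: le_trans (_ : (`|K| + 1) * nrm (a k - l) <= _).
  by have := ler_norm K; have := nrm_ge0 (a k - l); nra.
by move: hk; rewrite ler_pdivlMr // mulrC.
Qed.

Lemma convergesM (c : R[i]) (a : nat -> R[i]) l :
  converges a l -> converges (fun k => c * a k) (c * l).
Proof.
by apply: (converges_lip (K := nrm c)) => x y; rewrite -mulrBr nrmM.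
Qed.

Lemma approx_ge0 (d : R[i]) :
  (forall e : R, 0 < e -> exists2 z : R[i], 0 <= z & nrm (z - d) <= e) -> 0 <= d.
Proof.
move=> h; apply/ge0cP; split.
  apply/eqP; rewrite -normr_le0; apply/ler_addgt0Pr => e /h[z /ge0cP[iz _] hz].
  rewrite add0r; apply: le_trans hz.
  have := nrm_sqr (z - d); rewrite !ReImE iz => h'.
  rewrite -(ler_pXn2r (n := 2)) ?nnegrE ?nrm_ge0 // h' real_normK ?num_real //.
  by rewrite sub0r sqrrN lerDr sqr_ge0.
apply/ler_addgt0Pr => e /h[z /ge0cP[_ rz] hz].
have := Re_le_nrm (z - d); rewrite !ReImE => h'.
by have := ler_norm (Re z - Re d); lra.
Qed.

Lemma converges_ge0 (a : nat -> R[i]) l :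
  (forall k, 0 <= a k) -> converges a l -> 0 <= l.
Proof.
by move=> a0 al; apply: approx_ge0 => e /al[n /(_ n (leqnn n))]; exists (a n).
Qed.

Lemma closure_nrm (V : normedModType R[i]) (A : set V) x :
  closure A x <-> forall e : R, 0 < e -> exists2 y, A y & nrm (x - y) <= e.
Proof.
split=> [cA e e0|h B /nbhs_ballP[e /= e0 eB]].
  have e0' : 0 < e%:C by rewrite ltcR.
  have [y [Ay]] := cA _ (nbhsx_ballx x _ e0').
  by rewrite -ball_normE /= nrmE ltcR => /ltW xy; exists y.
move: (e0); rewrite ltcE /= => /andP[/eqP ie re].
have [y Ay xy] := h (Re e / 2) (divr_gt0 re (ltr0n _ 2)).
exists y; split=> //; apply: eB; rewrite -ball_normE /= nrmE.
by rewrite ltcE /= ie eqxx /=; lra.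
Qed.

Lemma cauchy_converges (V : completeNormedModType R[i]) (a : nat -> V) :
  cauchy_sequence a -> exists l, converges a l.
Proof.
move=> ca; have /cvg_ex[l /= al] : cvg (a @ \oo).
  apply: cauchy_cvg; apply/cauchy_ballP => e /=.
  rewrite ltcE /= => /andP[/eqP ie re].
  have [n hn] := ca (Re e / 2) (divr_gt0 re (ltr0n _ 2)).
  exists (a @` [set k | (n <= k)%N], a @` [set k | (n <= k)%N]).
    by split; exists n => //= k nk; exists k.
  move=> [_ _] /= [[k nk <-] [m nm <-]]; rewrite -ball_normE /= nrmE.
  by rewrite ltcE /= ie eqxx /=; have := hn k m nk nm; lra.
exists l => e e0; have e0' : 0 < e%:C by rewrite ltcR.
have [n _ hn] := al _ (nbhsx_ballx l _ e0'); exists n => k nk.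
by have := hn k nk; rewrite /= -ball_normE /= nrmE ltcR nrm_distC => /ltW.
Qed.

End Limits.

(** * Hilbert spaces *)

Section LinearMaps.
Variables (R : realType) (U V : lmodType R[i]) (f : U -> V).
Hypothesis lf : linear f.

Lemma linD x y : f (x + y) = f x + f y.
Proof. by have := lf 1 x y; rewrite !scale1r. Qed.
Lemma lin0 : f 0 = 0.
Proof. by apply: (addrI (f 0)); rewrite -linD !addr0. Qed.
Lemma linZ c x : f (c *: x) = c *: f x.
Proof. by have := lf c x 0; rewrite lin0 !addr0. Qed.
Lemma linN x : f (- x) = - f x.
Proof. by rewrite -scaleN1r linZ scaleN1r. Qed.
Lemma linB x y : f (x - y) = f x - f y.
Proof. by rewrite linD linN. Qed.
End LinearMaps.

Section Hilbert.
Variables (R : realType) (H : hilbertType R).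
Implicit Types (u v w : H) (c : R[i]).

Lemma hdotC u v : hdot u v = conjC (hdot v u).
Proof. by rewrite (hermC hdot) /= expr0 mul1r. Qed.

Lemma hdotDl u v w : hdot (u + v) w = hdot u w + hdot v w.
Proof. exact: linearDl. Qed.
Lemma hdotNl u w : hdot (- u) w = - hdot u w.
Proof. exact: linearNl. Qed.
Lemma hdotBl u v w : hdot (u - v) w = hdot u w - hdot v w.
Proof. exact: linearBl. Qed.
Lemma hdotZl c u w : hdot (c *: u) w = c * hdot u w.
Proof. exact: linearZl_LR. Qed.
Lemma hdot0l w : hdot 0 w = 0. Proof. exact: linear0l. Qed.
Lemma hdotDr u v w : hdot w (u + v) = hdot w u + hdot w v.
Proof. exact: linearDr. Qed.
Lemma hdotNr u w : hdot w (- u) = - hdot w u.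
Proof. exact: linearNr. Qed.
Lemma hdotBr u v w : hdot w (u - v) = hdot w u - hdot w v.
Proof. exact: linearBr. Qed.
Lemma hdotZr c u w : hdot w (c *: u) = conjC c * hdot w u.
Proof. exact: linearZr_LR. Qed.
Definition hdotE := (hdotDl, hdotBl, hdotNl, hdotZl, hdotDr, hdotBr, hdotNr, hdotZr).

Lemma hdot_self (x : H) : hdot x x = (nrm x ^+ 2)%:C.
Proof. by rewrite -hdot_norm nrmE rmorphXn. Qed.

Lemma nrm_sq (x : H) : nrm x ^+ 2 = Re (hdot x x).
Proof. by rewrite hdot_self. Qed.

Lemma hdot_ge0 (x : H) : 0 <= hdot x x.
Proof. by rewrite hdot_self lecR sqr_ge0. Qed.

Lemma nrm_le_sq (V : normedZmodType R[i]) (x : V) (r : R) :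
  0 <= r -> nrm x ^+ 2 <= r ^+ 2 -> nrm x <= r.
Proof. by move=> r0; rewrite ler_pXn2r ?nnegrE ?nrm_ge0. Qed.

Lemma cauchy_schwarz (x y : H) : nrm (hdot x y) <= nrm x * nrm y.
Proof.
apply: nrm_le_sq; first by rewrite mulr_ge0 ?nrm_ge0.
have [||_ _] := quadratic_ge0 (a := hdot y y) (b := hdot x y) (b' := hdot y x) (d := hdot x x).
- exact: hdot_ge0.
- move=> z; suff -> : hdot x x + z * hdot y x + conjC z * hdot x y + z * conjC z * hdot y y
    = hdot (x + z *: y) (x + z *: y) by exact: hdot_ge0.
  by rewrite !hdotE; ring.
by rewrite -nrm_sqr -!nrm_sq exprMn mulrC.
Qed.

Lemma Re_hdot_le (x y : H) : `|Re (hdot x y)| <= nrm x * nrm y.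
Proof. exact: le_trans (Re_le_nrm _) (cauchy_schwarz x y). Qed.

Lemma nrmD_sq u v : nrm (u + v) ^+ 2 = nrm u ^+ 2 + nrm v ^+ 2 + 2 * Re (hdot u v).
Proof.
by rewrite !nrm_sq !hdotE !ReImE (hdotC v u) !ReImE; ring.
Qed.

Lemma converges_hdotl (a : nat -> H) l v :
  converges a l -> converges (fun k => hdot (a k) v) (hdot l v).
Proof.
apply: (converges_lip (f := hdot ^~ v) (K := nrm v)) => x y /=.
by rewrite -hdotBl mulrC cauchy_schwarz.
Qed.

Lemma hdot_inj u v : (forall w, hdot w u = hdot w v) -> u = v.
Proof.
move=> h; apply/eqP; rewrite -subr_eq0; apply/eqP/nrm_eq0/eqP.
by rewrite -(sqrf_eq0 (nrm _)) nrm_sq hdotBr h subrr.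
Qed.

(** * Bounded operators *)

Lemma bounded_opP (T : H -> H) : bounded_op T <->
  linear T /\ exists2 M : R, 0 <= M & forall x, nrm (T x) <= M * nrm x.
Proof.
split=> -[lT [M]].
  move=> hM; split=> //; exists `|M| => // x; have := hM x.
  rewrite !nrmE -rmorphM lecR => /le_trans; apply.
  by rewrite ler_wpM2r ?nrm_ge0 ?ler_norm.
by move=> M0 hM; split=> //; exists M => x; rewrite !nrmE -rmorphM lecR.
Qed.

Lemma bounded_linear (T : H -> H) : bounded_op T -> linear T.
Proof. by case. Qed.

Lemma bounded_opD c (T S : H -> H) : bounded_op T -> bounded_op S ->
  bounded_op (c \*: T \+ S).
Proof.
move=> /bounded_opP[lT [M M0 hM]] /bounded_opP[lS [N N0 hN]].
apply/bounded_opP; split.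
  move=> a u v /=; rewrite lT lS !scalerDr !scalerA (mulrC c a) !addrA.
  by congr (_ + _); rewrite -!addrA; congr (_ + _); rewrite addrC.
exists (nrm c * M + N) => [|x]; first by rewrite addr_ge0 ?mulr_ge0 ?nrm_ge0.
apply: le_trans (nrmD _ _) _; rewrite nrmZ mulrDl -mulrA lerD //.
by rewrite ler_wpM2l ?nrm_ge0.
Qed.

Lemma bounded_op_comp (T S : H -> H) : bounded_op T -> bounded_op S ->
  bounded_op (T \o S).
Proof.
move=> /bounded_opP[lT [M M0 hM]] /bounded_opP[lS [N N0 hN]].
apply/bounded_opP; split; first by move=> a u v /=; rewrite lS lT.
exists (M * N) => [|x]; first exact: mulr_ge0.
by apply: le_trans (hM _) _; rewrite -mulrA ler_wpM2l.
Qed.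

Lemma bounded_op_id : bounded_op (@idfun H).
Proof. by apply/bounded_opP; split=> //; exists 1 => // x; rewrite mul1r. Qed.

(** * Representation of functionals and of sesquilinear forms *)

Lemma archimedean_inv (e : R) : 0 < e ->
  exists N, forall n, (N <= n)%N -> n.+1%:R^-1 <= e.
Proof.
move=> e0; exists (Num.bound e^-1) => n Nn.
rewrite -[leRHS]invrK lef_pV2 ?posrE ?invr_gt0 ?ltr0n //.
apply: le_trans (ltW (archi_boundP _)) _; first by rewrite invr_ge0 ltW.
by rewrite ler_nat (leq_trans Nn).
Qed.

(** The vector minimising [nrm v ^+ 2 / 2 - Re (f v)] represents [f].  A
    minimising sequence is Cauchy by the parallelogram law.  With [j] the
    identity this is the Riesz theorem, and in general it also provides
    projections onto closed subspaces: [f] is then a scalar product restricted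
    to the range of [j]. *)
Lemma riesz_range (X : lmodType R[i]) (j : X -> H) (f : X -> R[i]) (C : R) :
  linear j -> scalar f -> (forall x, nrm (f x) <= C * nrm (j x)) ->
  exists2 eta, closure (range j) eta & forall x, f x = hdot (j x) eta.
Proof.
move=> lj lf fC.
have lf' : linear (f : X -> R[i]^o) by [].
pose q x := nrm (j x) ^+ 2 - 2 * Re (f x).
have q_lb x : - C ^+ 2 <= q x.
  rewrite /q; have := fC x; have := Re_le_nrm (f x); have := ler_norm (Re (f x)).
  by have := nrm_ge0 (j x); have := sqr_ge0 (nrm (j x) - C); nra.
have hinf : has_inf (range q).
  by split; [exists (q 0), 0 | exists (- C ^+ 2) => _ [x _ <-]].
pose m := inf (range q).
have mq x : m <= q x by apply: ge_inf; [exact: hinf.2 | exists x].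
have /choice[x_ hx] : forall n, exists x, q x < m + n.+1%:R^-1.
  move=> n; have [|_ [x _ <-]] := inf_adherent (eps := n.+1%:R^-1) _ hinf.
    by rewrite invr_gt0 ltr0n.
  by exists x.
have para x y : nrm (j x - j y) ^+ 2 <= 2 * (q x - m) + 2 * (q y - m).
  have := mq (2^-1 *: (x + y)); rewrite /q (linZ lj) (linD lj) nrmZ.
  rewrite (linZ lf') (linD lf') /=.
  have -> : nrm (2^-1 : R[i]) = 2^-1.
    by rewrite (_ : 2^-1 = (2^-1 : R)%:C) ?nrm_real ?ger0_norm // fmorphV rmorph_nat.
  have -> : Re (2^-1 *: ((f x : R[i]^o) + f y)) = 2^-1 * (Re (f x) + Re (f y)).
    rewrite (_ : 2^-1 = (2^-1 : R)%:C :> R[i]); last by rewrite fmorphV rmorph_nat.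
    by rewrite [_ *: _]/(_ * _) !ReImE /= mul0r subr0.
  rewrite exprMn (_ : 2^-1 ^+ 2 = 4^-1 :> R); last by field.
  rewrite !nrmD_sq nrmN hdotNr cReN; lra.
have small (e : R) : 0 < e -> exists N, forall n, (N <= n)%N -> q (x_ n) - m <= e.
  move=> /archimedean_inv[N hN]; exists N => n /hN.
  by apply: le_trans; rewrite lerBlDl ltW.
have [|eta heta] := cauchy_converges (a := j \o x_).
  move=> e e0; have [|N hN] := small (e ^+ 2 / 4); first by rewrite divr_gt0 ?exprn_gt0.
  exists N => k n /hN hk /hN hn; apply: nrm_le_sq; first exact: ltW.
  by have := para (x_ k) (x_ n) => /=; lra.
exists eta.
  apply/closure_nrm => e /heta[n /(_ n (leqnn n))]; exists (j (x_ n)); first by exists (x_ n).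
  by rewrite nrm_distC.
move=> x; pose d := hdot (j x) eta - f x.
have key c : 0 <= nrm c ^+ 2 * nrm (j x) ^+ 2 + 2 * Re (c * d).
  pose K := 1 + 2 * nrm c * nrm (j x).
  have K0 : 0 < K by rewrite ltr_pwDl // !mulr_ge0 ?nrm_ge0.
  apply/ler_addgt0Pr => e e0; have [s s0 ->] : exists2 s : R, 0 < s & e = K * s.
    by exists (e / K); [rewrite divr_gt0 | rewrite mulrC divfK ?gt_eqF].
  have [N hN] := small _ s0; have [N' hN'] := heta _ s0.
  have {hN}h1 := hN (maxn N N') (leq_maxl _ _).
  have {hN'}h2 := hN' (maxn N N') (leq_maxr _ _).
  move: h1 h2 => /=; set y := x_ _ => h1 h2.
  have := mq (c *: x + y); move: h1; rewrite /q lj lf nrmD_sq nrmZ exprMn hdotZl.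
  have h3 := cauchy_schwarz (j x) (j y - eta).
  have h4 : Re (c * hdot (j x) (j y - eta)) <= nrm c * (nrm (j x) * s).
    apply: le_trans (ler_norm _) _; apply: le_trans (Re_le_nrm _) _.
    rewrite nrmM ler_wpM2l ?nrm_ge0 //; apply: le_trans h3 _.
    by rewrite ler_wpM2l ?nrm_ge0.
  move: h4; rewrite /d /K hdotBr !mulrBr !ReImE; lra.
have [||_ _] := quadratic_ge0 (a := (nrm (j x) ^+ 2)%:C) (b := conjC d) (b' := d) (d := 0).
- by rewrite lecR sqr_ge0.
- move=> z; rewrite add0r; apply/ge0cP; have := key z; have := nrm_sqr z.
  by rewrite !ReImE /= => ->; split; [ring | lra].
rewrite -nrm_sqr cRe0 mulr0 nrm_conj => d0.
have /nrm_eq0/eqP : nrm d = 0.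
  by apply/eqP; rewrite -sqrf_eq0 eq_le d0 sqr_ge0.
by rewrite subr_eq0 => /eqP.
Qed.

(** If [w] is close to [v], then [hdot w v] is close to [nrm v ^+ 2]. *)
Lemma approx_nrm_le v (M : R) : 0 <= M ->
  (forall e : R, 0 < e -> exists2 w, nrm (hdot w v) <= M * nrm w & nrm (v - w) <= e) ->
  nrm v <= M.
Proof.
move=> M0 h; have [->|v0] := eqVneq v 0; first by rewrite nrm0.
have vp : 0 < nrm v.
  by rewrite lt_def nrm_ge0 andbT; apply: contra_neq v0 => /nrm_eq0.
apply/ler_addgt0Pr => e e0.
pose K := nrm v + M + 1; have K0 : 0 < K by rewrite /K; lra.
pose s := e * nrm v / K; have s0 : 0 < s by rewrite divr_gt0 ?mulr_gt0.
have [w hw hx] := h s s0.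
have h1 : nrm v ^+ 2 <= nrm (v - w) * nrm v + M * nrm w.
  have -> : nrm v ^+ 2 = nrm (hdot v v) by rewrite hdot_self nrm_real ger0_norm ?sqr_ge0.
  rewrite -{1}(subrK w v) hdotDl; apply: le_trans (nrmD _ _) _.
  by rewrite lerD // cauchy_schwarz.
have h2 : nrm w <= nrm v + s by have := nrm_le_dist w v; rewrite nrm_distC; lra.
rewrite -(ler_pM2r vp).
have sK : s * (nrm v + M) <= e * nrm v.
  apply: le_trans (_ : s * K <= _); first by rewrite ler_wpM2l ?(ltW s0) // /K; lra.
  by rewrite /s divfK ?gt_eqF.
move: h1; rewrite expr2; nra.
Qed.

Section ClosedRange.
Variables (X : lmodType R[i]) (j : X -> H).
Hypothesis lj : linear j.

Lemma closure_range_linear c u v :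
  closure (range j) u -> closure (range j) v -> closure (range j) (c *: u + v).
Proof.
move=> /closure_nrm hu /closure_nrm hv; apply/closure_nrm => e e0.
pose K := nrm c + 1; have K0 : 0 < K by rewrite ltr_wpDl ?nrm_ge0.
have [s s0 ->] : exists2 s, 0 < s & e = s * K.
  by exists (e / K); rewrite ?divr_gt0 // divfK // gt_eqF.
have [_ [x _ <-] h1] := hu s s0; have [_ [y _ <-] h2] := hv s s0.
exists (j (c *: x + y)); first by exists (c *: x + y).
rewrite lj opprD addrACA -scalerBr; apply: le_trans (nrmD _ _) _.
by rewrite nrmZ /K; have := nrm_ge0 c; nra.
Qed.

Lemma closed_range_nrm_le v (M : R) : closure (range j) v -> 0 <= M ->
  (forall x, nrm (hdot (j x) v) <= M * nrm (j x)) -> nrm v <= M.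
Proof.
move=> /closure_nrm cv M0 h; apply: approx_nrm_le => // e /cv[_ [x _ <-] hx].
by exists (j x).
Qed.

Lemma closed_range_inj u v : closure (range j) u -> closure (range j) v ->
  (forall x, hdot (j x) u = hdot (j x) v) -> u = v.
Proof.
move=> cu cv h; apply/eqP; rewrite -subr_eq0; apply/eqP/nrm_eq0/eqP.
rewrite eq_le nrm_ge0 andbT; apply: closed_range_nrm_le => [||x] //.
  by rewrite addrC -scaleN1r; exact: closure_range_linear.
by rewrite hdotBr h subrr nrm0 mul0r.
Qed.

(** The projection of [v] represents the functional [hdot _ v] on the range. *)
Lemma projection_exists : exists p : H -> H, [/\ bounded_op p,
  forall v, closure (range j) (p v) & forall x v, hdot (j x) (p v) = hdot (j x) v].
Proof.
have /choice[p hp] : forall v, exists w, closure (range j) w /\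
    forall x, hdot (j x) w = hdot (j x) v.
  move=> v; have [||w cw h] := @riesz_range X j (fun x => hdot (j x) v) (nrm v) lj.
  - by move=> c x y; rewrite lj hdotDl hdotZl.
  - by move=> x; rewrite mulrC cauchy_schwarz.
  by exists w; split.
exists p; split; [|by move=> v; have [] := hp v|by move=> x v; have [] := hp v].
apply/bounded_opP; split.
  move=> c u v; have [cu hu] := hp u; have [cv hv] := hp v; have [cw hw] := hp (c *: u + v).
  apply: closed_range_inj => // [|x]; first exact: closure_range_linear.
  by rewrite hw !hdotE hu hv.
exists 1 => // v; have [cv hv] := hp v; rewrite mul1r.
apply: closed_range_nrm_le => // [|x]; first exact: nrm_ge0.
by rewrite hv mulrC cauchy_schwarz.
Qed.

Definition adjoint_pair (T T' : H -> H) : Prop :=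
  forall x y, hdot (T x) y = hdot x (T' y).

Lemma adjoint_pair_sym T T' : adjoint_pair T T' -> adjoint_pair T' T.
Proof. by move=> h x y; rewrite hdotC -h -hdotC. Qed.

Lemma projection_commute (p T T' : H -> H) : bounded_op T -> adjoint_pair T T' ->
  (forall x, exists y, T (j x) = j y) -> (forall x, exists y, T' (j x) = j y) ->
  (forall v, closure (range j) (p v)) -> (forall x v, hdot (j x) (p v) = hdot (j x) v) ->
  forall v, p (T v) = T (p v).
Proof.
move=> /bounded_opP[lT [M M0 hM]] adj Tj T'j cp hp v.
apply: closed_range_inj => // [|x].
  have /closure_nrm cpv := cp v; apply/closure_nrm => e e0.
  have K0 : 0 < M + 1 by rewrite ltr_wpDl.
  have [_ [x _ <-] hx] := cpv (e / (M + 1)) (divr_gt0 e0 K0).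
  have [y Ty] := Tj x; exists (j y); first by exists y.
  rewrite -Ty -(linB lT); apply: le_trans (hM _) _.
  move: hx; rewrite ler_pdivlMr //; have := nrm_ge0 (p v - j x); nra.
have [y T'y] := T'j x.
by rewrite hp -(adjoint_pair_sym adj) -[RHS](adjoint_pair_sym adj) T'y hp.
Qed.

End ClosedRange.

Section DenseRange.
Variables (X : lmodType R[i]) (j : X -> H).
Hypotheses (lj : linear j) (dj : closure (range j) = setT).

Let cj v : closure (range j) v. Proof. by rewrite dj. Qed.

Lemma dense_approx v (e : R) : 0 < e -> exists x, nrm (v - j x) <= e.
Proof. by have /closure_nrm h := @cj v; move=> /h[_ [x _ <-]]; exists x. Qed.

Lemma dense_nrm_le v (M : R) : 0 <= M ->
  (forall x, nrm (hdot (j x) v) <= M * nrm (j x)) -> nrm v <= M.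
Proof. exact: closed_range_nrm_le. Qed.

Lemma dense_inj u v : (forall x, hdot (j x) u = hdot (j x) v) -> u = v.
Proof. exact: closed_range_inj. Qed.

Lemma dense_op_eq (T S : H -> H) : bounded_op T -> bounded_op S ->
  (forall x, T (j x) = S (j x)) -> forall v, T v = S v.
Proof.
move=> /bounded_opP[lT [M M0 hM]] /bounded_opP[lS [N N0 hN]] h v.
apply/eqP; rewrite -subr_eq0; apply/eqP; apply: (@nrm_le_eps _ _ (M + N)) => e e0.
have [x hx] := dense_approx v e0.
have -> : T v - S v = T (v - j x) - S (v - j x).
  by rewrite (linB lT) (linB lS) h opprB addrA subrK.
apply: le_trans (nrmB _ _) _; have := hM (v - j x); have := hN (v - j x); nra.
Qed.

Lemma dense_positive_op (T : H -> H) : bounded_op T ->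
  (forall x, 0 <= hdot (T (j x)) (j x)) -> forall v, 0 <= hdot (T v) v.
Proof.
move=> /bounded_opP[lT [M M0 hM]] h v; apply: approx_ge0 => e e0.
pose K := M * (2 * nrm v + 1) + 1.
have K0 : 0 < K by rewrite ltr_wpDl // mulr_ge0 // addr_ge0 // mulr_ge0 ?nrm_ge0.
pose s := Num.min 1 (e / K); have s0 : 0 < s by rewrite lt_min ltr01 divr_gt0.
have s1 : s <= 1 by rewrite ge_min lexx.
have sK : s * K <= e.
  apply: le_trans (_ : e / K * K <= _); last by rewrite divfK ?gt_eqF.
  by rewrite ler_wpM2r ?(ltW K0) // ge_min lexx orbT.
have [x hx] := dense_approx v s0; set u := j x in hx; exists (hdot (T u) u); first exact: h.
have -> : hdot (T u) u - hdot (T v) v = hdot (T (u - v)) u + hdot (T v) (u - v).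
  by rewrite (linB lT) hdotBl hdotBr addrA subrK.
rewrite nrm_distC in hx.
apply: le_trans (nrmD _ _) _.
have := cauchy_schwarz (T (u - v)) u; have := cauchy_schwarz (T v) (u - v).
have uv : nrm u <= nrm v + 1 by have := nrm_le_dist u v; lra.
have h1 : nrm (T (u - v)) * nrm u <= (M * s) * (nrm v + 1).
  by rewrite ler_pM ?nrm_ge0 // (le_trans (hM _)) // ler_wpM2l.
have h2 : nrm (T v) * nrm (u - v) <= (M * nrm v) * s by rewrite ler_pM ?nrm_ge0.
by move: sK; rewrite /K; lra.
Qed.

Lemma sesquilinear_op (B : X -> X -> R[i]) (C : R) : 0 <= C ->
  (forall y, scalar (B ^~ y)) ->
  (forall x c y y', B x (c *: y + y') = conjC c * B x y + B x y') ->
  (forall x y, nrm (B x y) <= C * nrm (j x) * nrm (j y)) ->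
  exists2 S : H -> H, bounded_op S & forall x y, B x y = hdot (j x) (S (j y)).
Proof.
move=> C0 lB aB BC.
(* First the action on the range of [j], through the functionals [B x]. *)
have /choice[g hg] : forall x, exists eta, forall y, B x y = hdot eta (j y).
  move=> x; have [||eta _ h] := @riesz_range X j (fun y => conjC (B x y)) (C * nrm (j x)) lj.
  - by move=> c y y'; rewrite aB !conjcE.
  - by move=> y; rewrite nrm_conj.
  by exists eta => y; rewrite hdotC -h conjCKc.
have g_nrm x : nrm (g x) <= C * nrm (j x).
  apply: dense_nrm_le => [|y]; first by rewrite mulr_ge0 ?nrm_ge0.
  by rewrite hdotC nrm_conj -hg.
have lg : linear g.
  move=> c x x'; apply: dense_inj => y; rewrite !hdotE hdotC -hg lB.
  by rewrite !conjcE !hg -!(hdotC (j y)).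
(* Then the adjoint of that action, which is defined everywhere. *)
have /choice[S hS] : forall v, exists w, forall x, hdot (g x) v = hdot (j x) w.
  move=> v; have [||w _ h] := @riesz_range X j (fun x => hdot (g x) v) (C * nrm v) lj.
  - by move=> c x x'; rewrite lg hdotDl hdotZl.
  - move=> x; apply: le_trans (cauchy_schwarz _ _) _.
    by rewrite -mulrA (mulrC (nrm v)) mulrA ler_wpM2r ?nrm_ge0.
  by exists w.
exists S; last by move=> x y; rewrite hg hS.
apply/bounded_opP; split.
  by move=> c u v; apply: dense_inj => x; rewrite -hS !hdotE !hS.
exists C => // v; apply: dense_nrm_le => [|x]; first by rewrite mulr_ge0 ?nrm_ge0.
rewrite -hS; apply: le_trans (cauchy_schwarz _ _) _.
by rewrite -mulrA (mulrC (nrm v)) mulrA ler_wpM2r ?nrm_ge0.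
Qed.

End DenseRange.

Lemma closure_range_id : closure (range (@idfun H)) = setT.
Proof. by apply/seteqP; split=> // x _; apply: subset_closure; exists x. Qed.

Lemma adjoint_exists (T : H -> H) : bounded_op T ->
  exists2 S : H -> H, bounded_op S & forall x y, hdot (T x) y = hdot x (S y).
Proof.
move=> /bounded_opP[lT [M M0 hM]].
apply: (sesquilinear_op (j := idfun) _ closure_range_id M0 (B := fun x y => hdot (T x) y)).
- by [].
- by move=> y c x x'; rewrite lT hdotDl hdotZl.
- by move=> x c y y'; rewrite hdotDr hdotZr.
- move=> x y; apply: le_trans (cauchy_schwarz _ _) _.
  by rewrite ler_wpM2r ?nrm_ge0.
Qed.

(** * Positive operators *)

Definition positive_op (T : H -> H) : Prop := forall v, 0 <= hdot (T v) v.

Section PositiveOperator.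
Variable T : H -> H.
Hypotheses (lT : linear T) (T0 : positive_op T).

Lemma positive_op_form u v :
  hdot (T v) u = conjC (hdot (T u) v) /\
  nrm (hdot (T u) v) ^+ 2 <= Re (hdot (T v) v) * Re (hdot (T u) u).
Proof.
have [||-> _] := quadratic_ge0 (a := hdot (T v) v) (b := hdot (T u) v)
  (b' := hdot (T v) u) (d := hdot (T u) u).
- exact: T0.
- move=> z; have := T0 (u + z *: v); rewrite addrC lT !hdotE.
  by congr (0 <= _); ring.
by rewrite nrm_sqr.
Qed.

Lemma positive_op_hermitian : self_adjoint T.
Proof. by move=> x y; have [h _] := positive_op_form y x; rewrite h -hdotC. Qed.

(** The Cauchy-Schwarz inequality of the form [hdot (T _) _], at [u] and [T u]. *)
Lemma positive_op_sq (M : R) u : 0 <= M -> (forall v, Re (hdot (T v) v) <= M * nrm v ^+ 2) ->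
  nrm (T u) ^+ 2 <= M * Re (hdot (T u) u).
Proof.
move=> M0 hM; have [_] := positive_op_form u (T u).
rewrite hdot_self nrm_real ger0_norm ?sqr_ge0 //.
have [->|n0] := eqVneq (nrm (T u)) 0.
  by move=> _; rewrite expr0n mulr_ge0 //; have /ge0cP[] := T0 u.
have np : 0 < nrm (T u) ^+ 2 by rewrite exprn_gt0 // lt_def n0 nrm_ge0.
move=> h; rewrite -(ler_pM2r np) -[leLHS]expr2; apply: le_trans h _.
rewrite (mulrAC M) ler_wpM2r //; by have /ge0cP[] := T0 u.
Qed.

End PositiveOperator.

(** Once the second operator is normalised so as to lie between 0 and 1, iterating
    [S - S ^ 2] writes it as the sum of the squares of the iterates [S_k], and the
    summand [S_k ^ 2] contributes [hdot (T (S_k v)) (S_k v)]. *)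
Lemma positive_op_comm (T S : H -> H) : bounded_op T -> bounded_op S ->
  T \o S = S \o T -> positive_op T -> positive_op S -> positive_op (T \o S).
Proof.
move=> bT bS TS T0 S0 v.
have {}TS x : T (S x) = S (T x) by have := congr1 (@^~ x) TS.
have [[lT [M M0 hM]] [lS [N N0 hN]]] := (iffLR (bounded_opP T) bT, iffLR (bounded_opP S) bS).
have hT := positive_op_hermitian lT T0; have hS := positive_op_hermitian lS S0.
have im0 : Im (hdot (T (S v)) v) = 0.
  have : hdot (T (S v)) v = conjC (hdot (T (S v)) v) by rewrite -hdotC hT hS TS.
  by move=> /(congr1 (@complex.Im _)); rewrite cIm_conj => h; lra.
apply/ge0cP; split=> //=.
pose r := (N + 1)^-1; have r0 : 0 < r by rewrite invr_gt0 ltr_wpDl.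
pose Q n := iter n (fun (A : H -> H) x => A x - A (A x)) (fun x => r%:C *: S x).
have lQ n : linear (Q n).
  elim: n => [|n ih] c x y /=; first by rewrite lS scalerDr !scalerA mulrC.
  by rewrite !ih scalerBr opprD addrACA.
have QT n x : T (Q n x) = Q n (T x).
  elim: n x => [|n ih] x /=; first by rewrite (linZ lT) TS.
  by rewrite (linB lT) !ih.
have Q01 n : positive_op (Q n) /\ forall x, Re (hdot (Q n x) x) <= nrm x ^+ 2.
  elim: n => [|n [p1 p2]].
    split=> x; first by rewrite hdotZl mulr_ge0 ?S0 // lecR ltW.
    rewrite hdotZl cReM /= mul0r subr0 mulrC ler_pdivrMr ?ltr_wpDl //.
    have := cauchy_schwarz (S x) x; have := Re_le_nrm (hdot (S x) x).
    have := ler_norm (Re (hdot (S x) x)); have := hN x; have := nrm_ge0 x.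
    by rewrite mulrDr mulr1; nra.
  have hQ := positive_op_hermitian (lQ n) p1.
  have sq x : nrm (Q n x) ^+ 2 <= Re (hdot (Q n x) x).
    have := positive_op_sq (lQ n) p1 (M := 1) x ler01.
    by rewrite mul1r; apply=> y; rewrite mul1r.
  split=> x /=.
    rewrite hdotBl (hQ (Q n x)) hdot_self; have /ge0cP[i0 _] := p1 x.
    by apply/ge0cP; rewrite !ReImE /= i0 subr0 subr_ge0.
  rewrite hdotBl (hQ (Q n x)) hdot_self !ReImE /=.
  by have := p2 x; have := sqr_ge0 (nrm (Q n x)); lra.
have step n : Re (hdot (T (Q n.+1 v)) v) <= Re (hdot (T (Q n v)) v).
  rewrite /= (linB lT) hdotBl !ReImE (QT n (Q n v)).
  rewrite (positive_op_hermitian (lQ n) (Q01 n).1).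
  by have /ge0cP[_] := T0 (Q n v); lra.
have mono n : Re (hdot (T (Q n v)) v) <= Re (hdot (T (Q 0 v)) v).
  by elim: n => // n ih; apply: le_trans (step n) ih.
have -> : Re (hdot (T (S v)) v) = Re (hdot (T (Q 0 v)) v) / r.
  by rewrite /= (linZ lT) hdotZl cReM /= mul0r subr0 mulrC mulKf ?gt_eqF.
rewrite pmulr_lge0; last by rewrite invr_gt0.
rewrite leNgt; apply/negP; set x := Re _ => x0.
(* Otherwise the norms of the vectors [Q n v] would be bounded below, although
   their squares have a finite sum. *)
pose K := M * nrm v + 1; have K0 : 0 < K by rewrite ltr_wpDl ?mulr_ge0 ?nrm_ge0.
have low n : - x / K <= nrm (Q n v).
  rewrite ler_pdivrMr // mulrDr mulr1.
  have := Re_le_nrm (hdot (T (Q n v)) v); have := mono n; rewrite -/x.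
  have := cauchy_schwarz (T (Q n v)) v; have := hM (Q n v); have := nrm_ge0 v.
  have := ler_norm (- Re (hdot (T (Q n v)) v)); rewrite normrN.
  by have := nrm_ge0 (Q n v); nra.
pose d := (- x / K) ^+ 2.
have d0 : 0 < d by rewrite exprn_gt0 // divr_gt0 // oppr_gt0.
have sum n : Re (hdot (Q n v) v) <= nrm v ^+ 2 - n%:R * d.
  elim: n => [|n ih]; first by rewrite mul0r subr0; exact: (Q01 0).2.
  rewrite /= hdotBl (positive_op_hermitian (lQ n) (Q01 n).1 (Q n v)) hdot_self !ReImE /=.
  rewrite mulrS mulrDl mul1r.
  have : d <= nrm (Q n v) ^+ 2.
    by rewrite ler_pXn2r ?nnegrE ?nrm_ge0 ?low // divr_ge0 ?ltW // oppr_gt0.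
  by lra.
have := archi_boundP (x := nrm v ^+ 2 / d) (divr_ge0 (sqr_ge0 _) (ltW d0)).
set n := Num.bound _; rewrite ltr_pdivrMr //.
by have := sum n; have /ge0cP[_] := (Q01 n).1 v; lra.
Qed.

End Hilbert.

(** * Positive functionals and representations of C*-algebras *)

Section CStarAlgebra.
Variables (R : realType) (A : cstarType R).
Implicit Types (a b c x y z : A).

Lemma cmulBl x y z : (x - y) ** z = x ** z - y ** z.
Proof. by rewrite cmulDl -scaleN1r cmulZl scaleN1r. Qed.
Lemma cmulBr x y z : x ** (y - z) = x ** y - x ** z.
Proof. by rewrite cmulDr -scaleN1r cmulZr scaleN1r. Qed.
Lemma starN x : star (- x) = - star x.
Proof. by rewrite -scaleN1r starZ conjcN (conjCr 1) scaleN1r. Qed.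
Lemma starB x y : star (x - y) = star x - star y.
Proof. by rewrite starD starN. Qed.
Lemma star0 : star (0 : A) = 0.
Proof. by rewrite -(subrr (cone : A)) starB !subrr. Qed.
Lemma star1 : star (cone : A) = cone.
Proof. by have := starM (star (cone : A)) cone; rewrite cmul1r !starK cmul1r => <-. Qed.

Lemma nrm_cmul x y : nrm (x ** y) <= nrm x * nrm y.
Proof. by have := cstar_normM x y; rewrite !nrmE -rmorphM lecR. Qed.

Lemma nrm_starM x : nrm (star x ** x) = nrm x ^+ 2.
Proof. by have := cstar_norm x; rewrite !nrmE -rmorphXn => /complexI. Qed.

Lemma nrm_star x : nrm (star x) = nrm x.
Proof.
suff le y : nrm y <= nrm (star y).
  by apply/eqP; rewrite eq_le le -{2}[x]starK le.
have [->|y0] := eqVneq (nrm y) 0; first exact: nrm_ge0.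
rewrite -(@ler_pM2r _ (nrm y)) ?lt_def ?y0 ?nrm_ge0 //.
by rewrite -expr2 -nrm_starM nrm_cmul.
Qed.

Lemma star_lip x y : nrm (star x - star y) <= 1 * nrm (x - y).
Proof. by rewrite -starB nrm_star mul1r. Qed.

(** [1 - y] is a square root of [1 - b] as soon as [y] is a fixed point of
    [y |-> (b + y ^ 2) / 2], and this map contracts the ball of radius
    [1 - sqrt (1 - nrm b)]. *)
Lemma cstar_sqrt b : star b = b -> nrm b < 1 ->
  exists2 c, star c = c & cone - b = c ** c.
Proof.
move=> sb b1.
pose s := Num.sqrt (1 - nrm b); pose r := 1 - s.
have s2 : s ^+ 2 = 1 - nrm b by rewrite sqr_sqrtr // subr_ge0 ltW.
have s0 : 0 < s by rewrite sqrtr_gt0 subr_gt0.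
have b0 := nrm_ge0 b.
have r0 : 0 <= r by rewrite /r; nra.
have r1 : r < 1 by rewrite /r; lra.
have rE : nrm b + r ^+ 2 = 2 * r by rewrite /r; lra.
pose T y : A := 2^-1 *: (b + y ** y).
have half : nrm (2^-1 : R[i]) = 2^-1.
  by rewrite (_ : 2^-1 = (2^-1 : R)%:C) ?nrm_real ?ger0_norm // fmorphV rmorph_nat.
have Tr y : nrm y <= r -> nrm (T y) <= r.
  move=> yr; rewrite /T nrmZ half.
  have := nrmD b (y ** y); have := nrm_cmul y y; have := nrm_ge0 y; nra.
have Tc y z : nrm y <= r -> nrm z <= r -> nrm (T y - T z) <= r * nrm (y - z).
  move=> yr zr; rewrite /T -scalerBr nrmZ half opprD addrACA subrr add0r.
  have -> : y ** y - z ** z = y ** (y - z) + (y - z) ** z.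
    by rewrite cmulBr cmulBl addrA subrK.
  have := nrmD (y ** (y - z)) ((y - z) ** z).
  have := nrm_cmul y (y - z); have := nrm_cmul (y - z) z.
  by have := nrm_ge0 (y - z); nra.
pose y_ n := iter n T 0.
have yr n : nrm (y_ n) <= r by elim: n => [|n /Tr//]; rewrite nrm0.
have yc n k : nrm (y_ (n + k)%N - y_ n) <= r ^+ n.
  elim: n => [|n ih]; first by rewrite add0n subr0 expr0 (le_trans (yr k)) // ltW.
  by rewrite addSn exprS; apply: le_trans (Tc _ _ (yr _) (yr _)) _; rewrite ler_wpM2l.
have rn (e : R) : 0 < e -> exists n, r ^+ n <= e.
  move=> e0; have /cvgrPdist_le/(_ e e0)[n _ /(_ n (leqnn n))] : (fun n => r ^+ n) @ \oo --> (0 : R).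
    by apply: cvg_expr; rewrite ger0_norm.
  by rewrite sub0r normrN => h; exists n; apply: le_trans h; exact: ler_norm.
have [|y hy] := cauchy_converges (a := y_).
  move=> e e0; have [n hn] := rn (e / 2) (divr_gt0 e0 (ltr0n _ 2)).
  exists n => k m nk nm; apply: le_trans (nrm_triangle (y_ n) _ _) _.
  rewrite (nrm_distC (y_ n)).
  have := yc n (k - n)%N; have := yc n (m - n)%N; rewrite !subnKC //; lra.
have yy : nrm y <= r by apply: (converges_le (N := 0) _ hy) => k _; exact: yr.
have sy : star y = y.
  apply: (converges_unique (converges_lip star_lip hy)).
  apply: (converges_ext (N := 0) _ hy) => k _ /=.
  elim: k => [|k ih] /=; first by rewrite star0.
  rewrite /T starZ starD starM -ih sb; congr (_ *: _).
  by rewrite fmorphV rmorph_nat.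
have yT : T y = y.
  apply: (converges_unique _ (converges_shift hy)) => e e0.
  have [n hn] := hy e e0; exists n => k /hn; apply: le_trans.
  apply: le_trans (Tc _ _ (yr k) yy) _.
  by have := nrm_ge0 (y_ k - y); nra.
exists (cone - y); first by rewrite starB star1 sy.
rewrite cmulBr cmul1r cmulBl cmul1l.
have {1}-> : b = 2%:R *: y - y ** y.
  by rewrite -{1}yT /T scalerA divff ?pnatr_eq0 // scale1r addrK.
by rewrite scaler_nat mulr2n !opprD !opprK !addrA.
Qed.

Section PositiveFunctional.
Variable psi : A -> R[i].
Hypotheses (lpsi : scalar psi) (psi0 : forall x, 0 <= psi (star x ** x)).

Let lpsi' : linear (psi : A -> R[i]^o). Proof. by []. Qed.

Lemma functionalD x y : psi (x + y) = psi x + psi y. Proof. exact: (linD lpsi'). Qed.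
Lemma functionalB x y : psi (x - y) = psi x - psi y. Proof. exact: (linB lpsi'). Qed.
Lemma functionalZ (k : R[i]) x : psi (k *: x) = k * psi x. Proof. exact: (linZ lpsi'). Qed.

Lemma functional_cauchy_schwarz x y :
  psi (star x ** y) = conjC (psi (star y ** x)) /\
  nrm (psi (star y ** x)) ^+ 2 <= Re (psi (star y ** y)) * Re (psi (star x ** x)).
Proof.
have [||-> _] := quadratic_ge0 (a := psi (star y ** y)) (b := psi (star y ** x))
  (b' := psi (star x ** y)) (d := psi (star x ** x)).
- exact: psi0.
- move=> z; have := psi0 (x + z *: y).
  rewrite starD starZ !(cmulDl, cmulDr) !(cmulZl, cmulZr) !(functionalD, functionalZ).
  by congr (0 <= _); ring.
by rewrite nrm_sqr.
Qed.

Lemma functional_star x : psi (star x) = conjC (psi x).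
Proof.
by have [] := functional_cauchy_schwarz x cone; rewrite cmul1r star1 cmul1l.
Qed.

Lemma functional1_ge0 : 0 <= psi cone.
Proof. by have := psi0 cone; rewrite star1 cmul1l. Qed.

(** For [t > nrm x] the element [1 - t ^- 2 x^* x] is a square, by
    [cstar_sqrt]; so [psi] is nonnegative there, and [t] can tend to [nrm x]. *)
Lemma functional_square_le x : Re (psi (star x ** x)) <= nrm x ^+ 2 * Re (psi cone).
Proof.
have /ge0cP[_ p1] := functional1_ge0.
have key (t : R) : nrm x < t -> Re (psi (star x ** x)) <= t ^+ 2 * Re (psi cone).
  move=> xt; have t0 : 0 < t by apply: le_lt_trans xt; exact: nrm_ge0.
  have t20 : 0 < t ^+ 2 by rewrite exprn_gt0.
  have [||c sc h] := @cstar_sqrt ((t ^- 2)%:C *: (star x ** x)).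
  - by rewrite starZ starM starK conjCr.
  - rewrite nrmZ nrm_starM nrm_real ger0_norm ?invr_ge0 ?ltW //.
    rewrite mulrC ltr_pdivrMr // mul1r.
    by rewrite ltr_pXn2r ?nnegrE ?nrm_ge0 // ltW.
  have := psi0 c; rewrite sc -h functionalB functionalZ => /ge0cP[_].
  rewrite !ReImE /= mul0r subr0 subr_ge0 mulrC ler_pdivrMr //.
  by rewrite mulrC.
rewrite leNgt; apply/negP => lt.
pose g := Re (psi (star x ** x)); pose n := nrm x; pose p := Re (psi cone).
have n0 : 0 <= n := nrm_ge0 x.
have dg : 0 < g - n ^+ 2 * p by rewrite subr_gt0.
pose K := (2 * n + 1) * p + 1; have K0 : 0 < K by rewrite ltr_wpDl // mulr_ge0 // addr_ge0 // mulr_ge0.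
pose d := Num.min 1 ((g - n ^+ 2 * p) / (2 * K)).
have d0 : 0 < d by rewrite lt_min ltr01 divr_gt0 // mulr_gt0.
have d1 : d <= 1 by rewrite ge_min lexx.
have dK : d * K <= (g - n ^+ 2 * p) / 2.
  apply: le_trans (_ : (g - n ^+ 2 * p) / (2 * K) * K <= _).
    by rewrite ler_wpM2r ?(ltW K0) // ge_min lexx orbT.
  by rewrite invfM mulrA divfK // gt_eqF.
have := key (n + d); rewrite ltrDl d0 => /(_ isT); rewrite -/g -/p.
have : d ^+ 2 * p <= d * p by rewrite ler_wpM2r //; nra.
by move: dK; rewrite /K; nra.
Qed.

Lemma functional_bound x : nrm (psi x) <= nrm x * Re (psi cone).
Proof.
have /ge0cP[_ p1] := functional1_ge0.
apply: nrm_le_sq; first by rewrite mulr_ge0 ?nrm_ge0.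
have [_] := functional_cauchy_schwarz x cone; rewrite star1 !cmul1l => /le_trans; apply.
rewrite exprMn (mulrC (nrm x ^+ 2)) [Re _ ^+ 2]expr2 -mulrA ler_wpM2l //.
by rewrite mulrC functional_square_le.
Qed.

End PositiveFunctional.

Lemma state_nrm_le (psi : A -> R[i]) x : is_state psi -> nrm (psi x) <= nrm x.
Proof.
by move=> [l p p1]; have := functional_bound l p x; rewrite p1 cRe1 mulr1.
Qed.

End CStarAlgebra.

Section Representation.
Variable R : realType.

Definition representation (A : cstarType R) (H : hilbertType R) (rho : A -> H -> H) : Prop :=
  (forall a, bounded_op (rho a)) /\
  [/\ forall (c : R[i]) a b, rho (c *: a + b) = c \*: rho a \+ rho b,
      forall a b, rho (a ** b) = rho a \o rho b,
      rho cone = idfun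
    & forall a x y, hdot (rho a x) y = hdot x (rho (star a) y)].

Variables (A : cstarType R) (H : hilbertType R) (rho : A -> H -> H).
Hypothesis hrho : representation rho.

Lemma rep_linear a : linear (rho a).
Proof. exact: bounded_linear (hrho.1 a). Qed.

Lemma rep_linear_arg v : linear (rho ^~ v).
Proof. by move=> c a b /=; have [l _ _ _] := hrho.2; rewrite l. Qed.

Lemma repM a b v : rho (a ** b) v = rho a (rho b v).
Proof. by have [_ m _ _] := hrho.2; rewrite m. Qed.

Lemma rep1 v : rho cone v = v.
Proof. by have [_ _ u _] := hrho.2; rewrite u. Qed.

Lemma rep_adjoint a x y : hdot (rho a x) y = hdot x (rho (star a) y).
Proof. by have [_ _ _ s] := hrho.2. Qed.

Lemma rep_sq a v : hdot (rho (star a ** a) v) v = (nrm (rho a v) ^+ 2)%:C.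
Proof. by rewrite repM rep_adjoint starK hdot_self. Qed.

(** Each vector functional is positive, hence bounded by its value at the unit. *)
Lemma rep_nrm_le a v : nrm (rho a v) <= nrm a * nrm v.
Proof.
apply: nrm_le_sq; first by rewrite mulr_ge0 ?nrm_ge0.
have -> : nrm (rho a v) ^+ 2 = Re (hdot (rho (star a ** a) v) v) by rewrite rep_sq.
have := @functional_square_le R A (fun a => hdot (rho a v) v) _ _ a.
rewrite rep1 -nrm_sq exprMn; apply.
- by move=> c x y; rewrite (rep_linear_arg v) hdotDl hdotZl.
- by move=> x; rewrite rep_sq lecR sqr_ge0.
Qed.

End Representation.

Lemma representation_comp (R : realType) (A B : cstarType R) (H : hilbertType R)
    (rho : B -> H -> H) (p : starHom A B) :
  representation rho -> representation (rho \o p).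
Proof.
move=> [b [l m u s]]; split; first by move=> a /=.
split=> /=.
- by move=> c x y; rewrite linearP l.
- by move=> x y; rewrite homM m.
- by rewrite hom1 u.
- by move=> a x y; rewrite s homS.
Qed.

Lemma is_state_comp (R : realType) (A B : cstarType R) (psi : B -> R[i]) (p : starHom A B) :
  is_state psi -> is_state (psi \o p).
Proof.
move=> [l pos u]; split=> /=; last by rewrite hom1.
- by move=> c x y; rewrite /= linearP l.
- by move=> x; rewrite homM homS.
Qed.

Definition id_hom (R : realType) (A : cstarType R) : starHom A A :=
  @StarHom R A A idfun erefl (fun _ _ => erefl) (fun _ => erefl).

(** * Commutants and their normal states *)

Section Commutant.
Variables (R : realType) (H : hilbertType R) (S : set (H -> H)).
Implicit Types (T X Y Z : H -> H).

Definition adjoint_closed (N : set (H -> H)) : Prop :=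
  forall T, N T -> exists2 T', N T' & adjoint_pair T T'.

Lemma commutantP T : commutant S T <->
  bounded_op T /\ forall Y, S Y -> forall v, T (Y v) = Y (T v).
Proof.
split=> -[bT h]; split=> // Y SY; last by apply: funext => v; exact: h.
by move=> v; have := congr1 (@^~ v) (h Y SY).
Qed.

Lemma commutant_bounded T : commutant S T -> bounded_op T.
Proof. by case. Qed.

Lemma commutant_adjoint : adjoint_closed S -> adjoint_closed (commutant S).
Proof.
move=> aS T /commutantP[bT hT]; have [T' bT' h] := adjoint_exists bT.
exists T' => //; apply/commutantP; split=> // Y SY v.
have [Y' SY' hY] := aS Y SY.
apply: hdot_inj => w; rewrite -h.
by rewrite -(adjoint_pair_sym hY) -hT // h (adjoint_pair_sym hY).
Qed.

Hypothesis Sb : S `<=` bounded_op (H := H).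

Lemma commutantD c X Y : commutant S X -> commutant S Y -> commutant S (c \*: X \+ Y).
Proof.
move=> /commutantP[bX hX] /commutantP[bY hY]; apply/commutantP.
split; first exact: bounded_opD.
by move=> Z SZ v /=; rewrite (bounded_linear (Sb SZ)) hX // hY.
Qed.

Lemma commutant_comp X Y : commutant S X -> commutant S Y -> commutant S (X \o Y).
Proof.
move=> /commutantP[bX hX] /commutantP[bY hY]; apply/commutantP.
split; first exact: bounded_op_comp.
by move=> Z SZ v /=; rewrite hY // hX.
Qed.

Lemma commutant_id : commutant S idfun.
Proof. by apply/commutantP; split=> //; exact: bounded_op_id. Qed.

End Commutant.

Lemma op_le_trans (R : realType) (H : hilbertType R) (Y X Z : H -> H) :
  op_le X Y -> op_le Y Z -> op_le X Z.
Proof. by move=> h k x; apply: le_trans (h x) (k x). Qed.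

Lemma positive_opE (R : realType) (H : hilbertType R) (X : H -> H) :
  positive_op X <-> op_le (cst 0) X.
Proof. by split=> h v; have := h v; rewrite /= hdot0l. Qed.

(** A von Neumann algebra is represented as the commutant of an adjoint-closed
    set, a form in which closure under strong limits is immediate. *)
Section VonNeumannAlgebra.
Variables (R : realType) (H : hilbertType R) (S : set (H -> H)).
Hypotheses (Sb : S `<=` bounded_op (H := H)) (aS : adjoint_closed S).
Let M := commutant S.

Lemma vn_mem (X : M) : M (val X). Proof. exact: set_mem (valP X). Qed.

Lemma vn_element X : M X -> exists X' : M, val X' = X.
Proof. by move=> MX; exists (SigSub (mem_set MX)). Qed.

Lemma vn_linear (X : M) : linear (val X).
Proof. exact: bounded_linear (commutant_bounded (vn_mem X)). Qed.

(** A bounded increasing net of operators converges strongly: along it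
    [nrm ((Y' - Y) v) ^+ 2] is at most a constant times
    [hdot ((Y' - Y) v) v]. *)
Lemma increasing_net_cauchy (E : set M) (X Y0 : M) :
  E Y0 ->
  (forall Y1 Y2, E Y1 -> E Y2 ->
     exists Y3, [/\ E Y3, op_le (val Y1) (val Y3) & op_le (val Y2) (val Y3)]) ->
  (forall Y, E Y -> op_le (val Y) (val X)) ->
  exists2 K : R, 0 <= K & forall v (e : R), 0 < e -> exists Y, [/\ E Y, op_le (val Y0) (val Y) &
    forall Y', E Y' -> op_le (val Y) (val Y') ->
      nrm (val Y' v - val Y v) <= e /\ nrm (val Y' v - val Y0 v) <= K * nrm v].
Proof.
move=> EY0 dirE XE.
have /bounded_opP[_ [K1 K10 hK1]] := commutant_bounded (vn_mem X).
have /bounded_opP[_ [K2 K20 hK2]] := commutant_bounded (vn_mem Y0).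
pose K := K1 + K2; have K0 : 0 <= K by rewrite addr_ge0.
have diff (Y Y' : M) v : E Y' -> op_le (val Y0) (val Y) -> op_le (val Y) (val Y') ->
    nrm (val Y' v - val Y v) ^+ 2 <= K * (Re (hdot (val Y' v) v) - Re (hdot (val Y v) v)).
  move=> EY' Y0Y YY'.
  have lD : linear (fun v => val Y' v - val Y v).
    by move=> c x y; rewrite !vn_linear scalerBr opprD addrACA.
  have pD : positive_op (fun v => val Y' v - val Y v).
    by move=> x; rewrite hdotBl subr_ge0 YY'.
  rewrite -cReN -cReD -hdotBl; apply: (positive_op_sq lD pD) => // x.
  rewrite hdotBl !ReImE.
  have /lecP[_ h1] := Y0Y x; have /lecP[_ h2] := XE _ EY' x.
  have := Re_hdot_le (val X x) x; rewrite ler_norml => /andP[_ h3].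
  have := Re_hdot_le (val Y0 x) x; rewrite ler_norml => /andP[h4 _].
  have := hK1 x; have := hK2 x; have := nrm_ge0 x.
  rewrite /K; nra.
exists K => // v e e0.
pose A := [set Re (hdot (val Y v) v) | Y in [set Y | E Y /\ op_le (val Y0) (val Y)]].
have supA : has_sup A.
  split; first by exists (Re (hdot (val Y0 v) v)), Y0 => //; split=> // x.
  exists (Re (hdot (val X v) v)) => _ [Y [EY _] <-].
  by have /lecP[_] := XE Y EY v.
pose d := e ^+ 2 / (K + 1).
have K1p : 0 < K + 1 by rewrite ltr_wpDl.
have d0 : 0 < d by rewrite divr_gt0 ?exprn_gt0.
have [_ [Y [EY Y0Y] <-] hY] := sup_adherent d0 supA.
exists Y; split=> // Y' EY' YY'; have Y0Y' := op_le_trans Y0Y YY'.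
have hY' : Re (hdot (val Y' v) v) <= sup A by apply: ub_le_sup; [exact: supA.2 | exists Y'].
split; apply: nrm_le_sq.
- exact: ltW.
- apply: le_trans (diff Y Y' v EY' Y0Y YY') _.
  apply: le_trans (_ : (K + 1) * d <= _); last by rewrite /d mulrC divfK ?gt_eqF.
  by have /lecP[_] := YY' v; nra.
- by rewrite mulr_ge0 ?nrm_ge0.
apply: le_trans (diff Y0 Y' v EY' (fun x => lexx _) Y0Y') _.
rewrite exprMn [K ^+ 2]expr2 -mulrA ler_wpM2l //.
have /lecP[_ h2] := XE _ EY' v.
have := Re_hdot_le (val X v) v; rewrite ler_norml => /andP[_ h3].
have := Re_hdot_le (val Y0 v) v; rewrite ler_norml => /andP[h4 _].
have := hK1 v; have := hK2 v; have := nrm_ge0 v; rewrite /K; nra.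
Qed.

(** The limit is constructed vector by vector: at [v], members of the net that
    are within [1 / (n + 1)] of all later ones form a Cauchy sequence. *)
Lemma increasing_net_limit (E : set M) (X : M) :
  E !=set0 ->
  (forall Y1 Y2, E Y1 -> E Y2 ->
     exists Y3, [/\ E Y3, op_le (val Y1) (val Y3) & op_le (val Y2) (val Y3)]) ->
  (forall Y, E Y -> op_le (val Y) (val X)) ->
  exists Z : M, forall v (e : R), 0 < e -> exists2 Y, E Y &
    forall Y', E Y' -> op_le (val Y) (val Y') -> nrm (val Y' v - val Z v) <= e.
Proof.
move=> [Y0 EY0] dirE XE; have [K K0 hK] := increasing_net_cauchy EY0 dirE XE.
have lim v : exists z, forall e : R, 0 < e -> exists2 Y, E Y & forall Y', E Y' ->
    op_le (val Y) (val Y') -> nrm (val Y' v - z) <= e /\ nrm (val Y' v - val Y0 v) <= K * nrm v.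
  have /choice[Y_ hY] : forall n, exists Y : M, [/\ E Y, op_le (val Y0) (val Y) &
    forall Y', E Y' -> op_le (val Y) (val Y') ->
      nrm (val Y' v - val Y v) <= n.+1%:R^-1 /\ nrm (val Y' v - val Y0 v) <= K * nrm v].
    by move=> n; apply: hK; rewrite invr_gt0 ltr0n.
  have [|z hz] := cauchy_converges (a := fun n => val (Y_ n) v).
    move=> e e0; have [N hN] := archimedean_inv (divr_gt0 e0 (ltr0n _ 2) : 0 < e / 2).
    exists N => k m Nk Nm; have [Ek _ hk] := hY k; have [Em _ hm] := hY m.
    have [Y [EY /(hk _ EY)[h1 _] /(hm _ EY)[h2 _]]] := dirE _ _ Ek Em.
    apply: le_trans (nrm_triangle (val Y v) _ _) _; rewrite (nrm_distC (val (Y_ k) v)).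
    by move: (le_trans h1 (hN k Nk)) (le_trans h2 (hN m Nm)); lra.
  exists z => e e0; have e20 : 0 < e / 2 by rewrite divr_gt0.
  have [N hN] := archimedean_inv e20; have [N' hN'] := hz _ e20.
  pose n := maxn N N'; have [En _ hn] := hY n; exists (Y_ n) => // Y EY /(hn _ EY)[h1 h2].
  split=> //; apply: le_trans (nrm_triangle (val (Y_ n) v) _ _) _.
  by have := hN' n (leq_maxr _ _); have := le_trans h1 (hN n (leq_maxl _ _)) => /=; lra.
have [Z hZ] := choice lim.
have /bounded_opP[_ [K2 K20 hK2]] := commutant_bounded (vn_mem Y0).
have MZ : M Z.
  apply/commutantP; split.
    apply/bounded_opP; split.
      move=> c u v; apply/eqP; rewrite -subr_eq0; apply/eqP.
      apply: (@nrm_le_eps _ _ (2 + nrm c)) => e e0.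
      have [Y1 E1 h1] := hZ (c *: u + v) e e0.
      have [Y2 E2 h2] := hZ u e e0; have [Y3 E3 h3] := hZ v e e0.
      have [Y4 [E4 h14 h24]] := dirE _ _ E1 E2.
      have [Y [EY h4 /(h3 _ EY)[{}h3 _]]] := dirE _ _ E4 E3.
      have [{}h1 _] := h1 _ EY (op_le_trans h14 h4).
      have [{}h2 _] := h2 _ EY (op_le_trans h24 h4).
      have -> : Z (c *: u + v) - (c *: Z u + Z v) =
          (c *: (val Y u - Z u) + (val Y v - Z v)) - (val Y (c *: u + v) - Z (c *: u + v)).
        by rewrite vn_linear scalerBr [in RHS]addrACA -opprD opprB [RHS]addrC [RHS]addrA subrK.
      apply: le_trans (nrmB _ _) _; have := nrmD (c *: (val Y u - Z u)) (val Y v - Z v).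
      by rewrite nrmZ; have := nrm_ge0 c; nra.
    exists (K + K2) => [|v]; first exact: addr_ge0.
    apply/ler_addgt0Pr => e e0; have [Y EY hY] := hZ v e e0.
    have [h1 h2] := hY Y EY (fun x => lexx _).
    have := nrm_le_dist (Z v) (val Y v); have := nrm_le_dist (val Y v) (val Y0 v).
    by rewrite (nrm_distC (Z v)); have := hK2 v; lra.
  move=> W SW v; have /bounded_opP[lW [KW KW0 hKW]] := Sb SW.
  apply/eqP; rewrite -subr_eq0; apply/eqP; apply: (@nrm_le_eps _ _ (1 + KW)) => e e0.
  have [Y1 E1 h1] := hZ (W v) e e0; have [Y2 E2 h2] := hZ v e e0.
  have [Y [EY /(h1 _ EY)[{}h1 _] /(h2 _ EY)[{}h2 _]]] := dirE _ _ E1 E2.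
  have /commutantP[_ /(_ W SW v) YW] := vn_mem Y.
  have -> : Z (W v) - W (Z v) = W (val Y v - Z v) - (val Y (W v) - Z (W v)).
    by rewrite (linB lW) YW opprB [RHS]addrC [RHS]addrA subrK.
  apply: le_trans (nrmB _ _) _; have := hKW (val Y v - Z v); nra.
have [Z' Z'E] := vn_element MZ; rewrite -Z'E in hZ.
by exists Z' => v e /(hZ v)[Y EY hY]; exists Y => // Y' EY' /(hY _ EY')[].
Qed.

Section States.
Variable w : M -> R[i].
Hypothesis sw : vn_states M w.

Lemma vn_stateB (X Y Z : M) : (forall v, val Z v = val X v - val Y v) -> w Z = w X - w Y.
Proof.
move=> ZE; have [lin _ _] := sw; rewrite (lin (- 1) Y X Z) ?mulN1r 1?addrC //.
by apply: funext => v /=; rewrite ZE scaleN1r addrC.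
Qed.

(** Positivity of [w] at [(X + z)^* (X + z)] for all scalars [z]. *)
Lemma vn_state_cauchy_schwarz (X X' Q : M) : adjoint_pair (val X) (val X') ->
  val Q = val X' \o val X -> nrm (w X) ^+ 2 <= Re (w Q).
Proof.
move=> adj QE; have [lin pos one] := sw.
have [I IE] := vn_element (commutant_id S).
have [|_ _] := quadratic_ge0 (a := 1) (b := w X) (b' := w X') (d := w Q) ler01.
  move=> z.
  have [P1 P1E] := vn_element (commutantD Sb (z * conjC z) (vn_mem I) (vn_mem Q)).
  have [P2 P2E] := vn_element (commutantD Sb (conjC z) (vn_mem X) (vn_mem P1)).
  have [P3 P3E] := vn_element (commutantD Sb z (vn_mem X') (vn_mem P2)).
  suff -> : w Q + z * w X' + conjC z * w X + z * conjC z * 1 = w P3.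
    apply: pos => v; rewrite /= hdot0l P3E P2E P1E QE IE /=.
    suff -> : hdot (z *: val X' v + (conjC z *: val X v +
        ((z * conjC z) *: v + val X' (val X v)))) v = hdot (val X v + z *: v) (val X v + z *: v).
      exact: hdot_ge0.
    rewrite !hdotE (adjoint_pair_sym adj (val X v) v) (adjoint_pair_sym adj v v).
    ring.
  by rewrite (lin _ _ _ _ P3E) (lin _ _ _ _ P2E) (lin _ _ _ _ P1E) (one _ IE); ring.
by rewrite cRe1 mul1r nrm_sqr.
Qed.

Definition dominated (xi : H) (c : R) : Prop :=
  forall X : M, op_le (cst 0) (val X) -> w X <= c%:C * hdot (val X xi) xi.

Lemma dominated_cauchy_schwarz xi c (X : M) : dominated xi c ->
  nrm (w X) ^+ 2 <= c * nrm (val X xi) ^+ 2.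
Proof.
move=> dom; have [X0 MX' adj] := commutant_adjoint aS (vn_mem X).
have [X' X'E] := vn_element MX'; rewrite -X'E in adj.
have [Q QE] := vn_element (commutant_comp (vn_mem X') (vn_mem X)).
have QQ v : hdot (val Q v) v = (nrm (val X v) ^+ 2)%:C.
  by rewrite QE /= (adjoint_pair_sym adj) hdot_self.
apply: le_trans (vn_state_cauchy_schwarz adj QE) _.
have /dom/lecP[_] : op_le (cst 0) (val Q).
  by move=> v; rewrite /= hdot0l QQ lecR sqr_ge0.
by rewrite QQ !ReImE /= mul0r subr0.
Qed.

(** Normality passes to everything below a vector functional: the supremum [X]
    of an increasing net in [M] is its strong limit, so
    [hdot ((X - Y) xi) xi], and with it [w X - w Y], becomes arbitrarily small. *)
Lemma dominated_normal xi c : 0 <= c -> dominated xi c -> normal w.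
Proof.
move=> c0 dom E X E0 _ dirE [XE Xmin].
have [lin pos _] := sw.
have [Z hZ] := increasing_net_limit E0 dirE XE.
have XZ : op_le (val X) (val Z).
  apply: Xmin => Y EY v; rewrite -subr_ge0 -hdotBl.
  apply: approx_ge0 => e e0; pose s := e / (nrm v + 1).
  have v1 : 0 < nrm v + 1 by rewrite ltr_wpDl ?nrm_ge0.
  have [Y1 EY1 h1] := hZ v s (divr_gt0 e0 v1).
  have [Y2 [EY2 YY2 /(h1 _ EY2) {}h1]] := dirE _ _ EY EY1.
  exists (hdot (val Y2 v - val Y v) v); first by rewrite hdotBl subr_ge0 YY2.
  rewrite -hdotBl opprB addrA subrK; apply: le_trans (cauchy_schwarz _ _) _.
  have : s * (nrm v + 1) = e by rewrite divfK // gt_eqF.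
  by have := nrm_ge0 v; have := nrm_ge0 (val Y2 v - val Z v); nra.
have diff Y : E Y -> 0 <= w X - w Y <= c%:C * hdot (val X xi - val Y xi) xi.
  move=> EY; have [D DE] := vn_element (commutantD Sb (- 1) (vn_mem Y) (vn_mem X)).
  have DE' v : val D v = val X v - val Y v by rewrite DE /= scaleN1r addrC.
  have D0 : op_le (cst 0) (val D).
    by move=> v; rewrite /= hdot0l DE' hdotBl subr_ge0 XE.
  by rewrite -(vn_stateB DE') -DE' pos // dom.
split.
  by move=> _ [Y EY <-]; have /andP[] := diff Y EY; rewrite subr_ge0.
move=> b ub; have [Y0 EY0] := E0.
apply/lecP; split.
  have /lecP[-> _] := ub _ (ex_intro2 _ _ Y0 EY0 erefl).
  by have /andP[/ge0cP[+ _] _] := diff Y0 EY0; rewrite !ReImE => h; lra.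
apply/ler_addgt0Pr => e e0; pose K := c * nrm xi + 1.
have K0 : 0 < K by rewrite ltr_wpDl // mulr_ge0 ?nrm_ge0.
have [s s0 eE] : exists2 s, 0 < s & e = s * K.
  by exists (e / K); rewrite ?divr_gt0 // divfK // gt_eqF.
have [Y EY hY] := hZ xi s s0.
have {}hY := hY Y EY (fun v => lexx _).
have /lecP[_ h1] := ub _ (ex_intro2 _ _ Y EY erefl).
have /andP[_ /lecP[_]] := diff Y EY; rewrite !ReImE /= mul0r subr0 hdotBl !ReImE => h2.
have /lecP[_ h3] := XZ xi.
have := Re_hdot_le (val Z xi - val Y xi) xi; rewrite hdotBl !ReImE ler_norml => /andP[_ h4].
have h5 : c * (nrm (val Z xi - val Y xi) * nrm xi) <= e.
  have cx0 : 0 <= c * nrm xi by rewrite mulr_ge0 ?nrm_ge0.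
  rewrite nrm_distC eE /K mulrDr mulr1 mulrCA -[leLHS]addr0 lerD ?(ltW s0) //.
  by rewrite ler_wpM2r.
have h6 : c * (Re (hdot (val X xi) xi) - Re (hdot (val Y xi) xi)) <=
    c * (nrm (val Z xi - val Y xi) * nrm xi).
  by rewrite ler_wpM2l //; lra.
lra.
Qed.

End States.

Variable xi : H.
Hypothesis xi1 : hdot xi xi = 1.
Let phiM := restriction (M := M) (vector_functional xi).

Lemma vector_state : vn_states M phiM.
Proof.
split=> [c X Y Z ZE|X X0|X XE]; rewrite /phiM /restriction /vector_functional.
- by rewrite ZE /= hdotDl hdotZl.
- by have := X0 xi; rewrite /= hdot0l.
- by rewrite XE.
Qed.

Lemma vector_state_normal : normal phiM.
Proof.
apply: (dominated_normal vector_state ler01 (xi := xi)) => X _.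
by rewrite mul1r.
Qed.

Lemma vector_normal_state : normal_states M phiM.
Proof. by split; [exact: vector_state | exact: vector_state_normal]. Qed.

Lemma convex_dominated (w1 w2 : M -> R[i]) (t : R) : vn_states M w2 -> 0 < t < 1 ->
  phiM = (fun X => t%:C * w1 X + (1 - t)%:C * w2 X) -> dominated w1 xi t^-1.
Proof.
move=> [_ pos2 _] /andP[t0 t1] phiE X X0.
have := congr1 (@^~ X) phiE; rewrite /phiM /restriction /vector_functional => ->.
rewrite mulrDr mulrA -rmorphM mulVf ?gt_eqF // mul1r lerDl mulr_ge0 //.
  by rewrite lecR invr_ge0 ltW.
by rewrite mulr_ge0 ?pos2 // lecR subr_ge0 ltW.
Qed.

Lemma convex_sym (T : Type) (f w1 w2 : T -> R[i]) (t : R) :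
  f = (fun X => t%:C * w1 X + (1 - t)%:C * w2 X) ->
  f = (fun X => (1 - t)%:C * w2 X + (1 - (1 - t))%:C * w1 X).
Proof. by move=> ->; apply: funext => x; rewrite opprB addrCA subrr addr0 addrC. Qed.

Lemma onem_itv (t : R) : 0 < t < 1 -> 0 < 1 - t < 1.
Proof. by move=> /andP[t0 t1]; apply/andP; split; lra. Qed.

Lemma convex_normal (w1 w2 : M -> R[i]) (t : R) : vn_states M w1 -> vn_states M w2 ->
  0 < t < 1 -> phiM = (fun X => t%:C * w1 X + (1 - t)%:C * w2 X) -> normal w1.
Proof.
move=> s1 s2 t01 phiE; have /andP[t0 _] := t01.
apply: (dominated_normal s1 _ (convex_dominated s2 t01 phiE)).
by rewrite invr_ge0 ltW.
Qed.

(** The components of a convex decomposition of the vector state are dominated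
    by it, hence normal, so that decompositions into normal states and into
    arbitrary states are the same. *)
Lemma extreme_normal_pure :
  extreme_point (normal_states M) phiM <-> pure_state phiM /\ normal phiM.
Proof.
split=> [[nphi ext]|[[_ ext] nphi]].
  split; last exact: nphi.2.
  split=> [|w1 w2 t s1 s2 t01 phiE]; first exact: nphi.1.
  apply: (ext w1 w2 t) => //; split=> //; first exact: (convex_normal s1 s2 t01 phiE).
  exact: (convex_normal s2 s1 (onem_itv t01) (convex_sym phiE)).
split; first exact: vector_normal_state.
by move=> w1 w2 t [s1 _] [s2 _]; exact: ext.
Qed.

End VonNeumannAlgebra.

(** * Representations of the free product *)

Section FreeProduct.
Variables (R : realType) (A : cstarType R) (F : freeProduct A).
Implicit Types (x y z : F).

Definition star_subalgebra (B : set F) : Prop :=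
  [/\ B cone,
      forall (c : R[i]) x y, B x -> B y -> B (c *: x + y),
      forall x y, B x -> B y -> B (x ** y)
    & forall x, B x -> B (star x)].

(** The closure of a star subalgebra is a C*-subalgebra. *)
Lemma star_subalgebra_dense (B : set F) : star_subalgebra B ->
  (forall j a, B (fp_in F j a)) -> forall x (e : R), 0 < e -> exists2 y, B y & nrm (x - y) <= e.
Proof.
move=> [B1 BD BM BS] Bin x; apply/closure_nrm.
suff -> : closure B = setT by [].
apply: fp_gen => [|j a]; last exact: subset_closure.
split; first exact: closed_closure.
- exact: subset_closure.
- move=> c u v /closure_nrm hu /closure_nrm hv; apply/closure_nrm => e e0.
  pose K := nrm c + 1; have K0 : 0 < K by rewrite ltr_wpDl ?nrm_ge0.
  have [s s0 ->] : exists2 s, 0 < s & e = s * K.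
    by exists (e / K); rewrite ?divr_gt0 // divfK // gt_eqF.
  have [u' Bu' h1] := hu s s0; have [v' Bv' h2] := hv s s0.
  exists (c *: u' + v'); first exact: BD.
  rewrite opprD addrACA -scalerBr; apply: le_trans (nrmD _ _) _.
  by rewrite nrmZ /K; have := nrm_ge0 c; nra.
- move=> u v /closure_nrm hu /closure_nrm hv; apply/closure_nrm => e e0.
  pose K := nrm u + nrm v + 1; have K0 : 0 < K by rewrite ltr_wpDl ?addr_ge0 ?nrm_ge0.
  pose s := Num.min 1 (e / K); have s0 : 0 < s by rewrite lt_min ltr01 divr_gt0.
  have s1 : s <= 1 by rewrite ge_min lexx.
  have sK : s * K <= e.
    apply: le_trans (_ : e / K * K <= _); last by rewrite divfK ?gt_eqF.
    by rewrite ler_wpM2r ?(ltW K0) // ge_min lexx orbT.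
  have [u' Bu' h1] := hu s s0; have [v' Bv' h2] := hv s s0.
  exists (u' ** v'); first exact: BM.
  have -> : u ** v - u' ** v' = (u - u') ** v + u' ** (v - v').
    by rewrite cmulBl cmulBr addrA subrK.
  have hu' : nrm u' <= nrm u + s.
    by have := nrm_le_dist u' u; rewrite nrm_distC; lra.
  apply: le_trans (nrmD _ _) _; apply: le_trans (lerD (nrm_cmul _ _) (nrm_cmul _ _)) _.
  apply: le_trans sK; rewrite /K; have := nrm_ge0 v; have := nrm_ge0 u'; have := nrm_ge0 (v - v').
  have h3 : nrm (u - u') * nrm v <= s * nrm v by rewrite ler_wpM2r ?nrm_ge0.
  have h4 : nrm u' * nrm (v - v') <= (nrm u + s) * s.
    by rewrite ler_pM ?nrm_ge0.
  by nra.
- move=> u /closure_nrm hu; apply/closure_nrm => e /hu[u' Bu' h].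
  by exists (star u'); [exact: BS | rewrite -starB nrm_star].
Qed.

Section TwoRepresentations.
Variable H : hilbertType R.

(** Two representations agree, also at adjoints, on a star subalgebra; it is dense,
    and representations are contractive. *)
Lemma representation_unique (rho1 rho2 : F -> H -> H) :
  representation rho1 -> representation rho2 ->
  (forall j a, rho1 (fp_in F j a) = rho2 (fp_in F j a)) -> forall x v, rho1 x v = rho2 x v.
Proof.
move=> h1 h2 gen x v.
pose B : set F := [set x | (forall v, rho1 x v = rho2 x v) /\
  forall v, rho1 (star x) v = rho2 (star x) v].
have hB : star_subalgebra B.
  split=> [|c y z [ay by_] [az bz]|y z [ay by_] [az bz]|y [ay by_]].
  - by split=> u; rewrite ?star1 (rep1 h1) (rep1 h2).
  - split=> u; first by rewrite (rep_linear_arg h1 u) (rep_linear_arg h2 u) ay az.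
    by rewrite starD starZ (rep_linear_arg h1 u) (rep_linear_arg h2 u) by_ bz.
  - by split=> u; rewrite ?starM !(repM h1) !(repM h2) ?ay ?az ?by_ ?bz.
  - by split=> u; rewrite ?starK.
apply/eqP; rewrite -subr_eq0; apply/eqP; apply: (@nrm_le_eps _ _ (2 * nrm v)) => e e0.
have [|y [yE _] h] := star_subalgebra_dense hB _ x e0.
  by move=> j a; split=> u; rewrite -?homS gen.
have -> : rho1 x v - rho2 x v = rho1 (x - y) v - rho2 (x - y) v.
  by rewrite (linB (rep_linear_arg h1 v)) (linB (rep_linear_arg h2 v)) yE opprB addrA subrK.
apply: le_trans (nrmB _ _) _.
have := rep_nrm_le h1 (x - y) v; have := rep_nrm_le h2 (x - y) v; have := nrm_ge0 v; nra.
Qed.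

Lemma commutant_representation (rho : F -> H -> H) (Y : H -> H) :
  representation rho -> bounded_op Y ->
  (forall j a v, Y (rho (fp_in F j a) v) = rho (fp_in F j a) (Y v)) ->
  forall x v, Y (rho x v) = rho x (Y v).
Proof.
move=> hr /bounded_opP[lY [M M0 hM]] gen x v.
pose B : set F := [set x | (forall v, Y (rho x v) = rho x (Y v)) /\
  forall v, Y (rho (star x) v) = rho (star x) (Y v)].
have hB : star_subalgebra B.
  split=> [|c y z [ay by_] [az bz]|y z [ay by_] [az bz]|y [ay by_]].
  - by split=> u; rewrite ?star1 !(rep1 hr).
  - split=> u.
      by rewrite (rep_linear_arg hr u) (rep_linear_arg hr (Y u)) /= lY ay az.
    rewrite starD starZ (rep_linear_arg hr u) (rep_linear_arg hr (Y u)).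
    by rewrite /= lY by_ bz.
  - by split=> u; rewrite ?starM !(repM hr) ?ay ?az ?bz ?by_.
  - by split=> u; rewrite ?starK.
apply/eqP; rewrite -subr_eq0; apply/eqP; apply: (@nrm_le_eps _ _ (M * nrm v + nrm (Y v))) => e e0.
have [|y [yE _] h] := star_subalgebra_dense hB _ x e0.
  by move=> j a; split=> u; rewrite -?homS gen.
have -> : Y (rho x v) - rho x (Y v) = Y (rho (x - y) v) - rho (x - y) (Y v).
  rewrite (linB (rep_linear_arg hr v)) (linB (rep_linear_arg hr (Y v))) (linB lY).
  by rewrite yE opprB addrA subrK.
apply: le_trans (nrmB _ _) _; have := hM (rho (x - y) v).
have := rep_nrm_le hr (x - y) v; have := rep_nrm_le hr (x - y) (Y v).
have := nrm_ge0 v; have := nrm_ge0 (Y v); have := nrm_ge0 (x - y).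
move=> n1 n2 n3 h1 h2 h3.
have h4 : M * nrm (rho (x - y) v) <= M * (e * nrm v).
  by rewrite ler_wpM2l // (le_trans h2) // ler_wpM2r.
have h5 : nrm (x - y) * nrm (Y v) <= e * nrm (Y v) by rewrite ler_wpM2r.
by rewrite mulrDl; nra.
Qed.

End TwoRepresentations.

(** * Elements of finite support *)

(** Elements of the subalgebra generated by the first [n] copies, as far as
    homomorphisms can tell.  In this form stability under the algebraic operations
    is immediate. *)
Definition supported (n : nat) : set F := [set x |
  forall p q : starHom F F,
    (forall j a, (j < n)%N -> p (fp_in F j a) = q (fp_in F j a)) -> p x = q x].

Lemma supported_le n m : (n <= m)%N -> supported n `<=` supported m.
Proof. by move=> nm x hx p q h; apply: hx => j a jn; apply: h; exact: leq_trans nm. Qed.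

Lemma supported_dense x (e : R) : 0 < e -> exists n y, supported n y /\ nrm (x - y) <= e.
Proof.
move=> e0; pose B : set F := [set x | exists n, supported n x].
have [||y [n ny] h] := star_subalgebra_dense (B := B) _ _ x e0; last by exists n, y.
  split=> [|c y z [n hn] [m hm]|y z [n hn] [m hm]|y [n hn]].
  - by exists 0%N => p q _; rewrite !hom1.
  - exists (maxn n m) => p q h; rewrite !linearP /=.
    by rewrite (supported_le (leq_maxl _ _) hn h) (supported_le (leq_maxr _ _) hm h).
  - exists (maxn n m) => p q h; rewrite !homM /=.
    by rewrite (supported_le (leq_maxl _ _) hn h) (supported_le (leq_maxr _ _) hm h).
  - by exists n => p q h; rewrite !homS (hn p q h).
by move=> j a; exists j.+1 => p q h; apply: h.
Qed.

Lemma fp_endoE f j a : fp_endo F f (fp_in F j a) = fp_in F (f j) a.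
Proof. exact: fp_liftE. Qed.

Lemma supported_endo n f x : supported n x ->
  (forall j, (j < n)%N -> f j = j) -> fp_endo F f x = x.
Proof.
by move=> sx fE; apply: (sx (fp_endo F f) (id_hom F)) => j a jn; rewrite fp_endoE fE.
Qed.

Lemma state_ext (psi1 psi2 : F -> R[i]) : is_state psi1 -> is_state psi2 ->
  (forall n x, supported n x -> psi1 x = psi2 x) -> forall x, psi1 x = psi2 x.
Proof.
move=> s1 s2 h x; apply/eqP; rewrite -subr_eq0; apply/eqP.
apply: (@nrm_le_eps _ _ 2) => e e0; have [n [y [ny hy]]] := supported_dense x e0.
have [l1 _ _] := s1; have [l2 _ _] := s2.
have -> : psi1 x - psi2 x = psi1 (x - y) - psi2 (x - y).
  by rewrite (functionalB l1) (functionalB l2) (h n y ny) opprB addrA subrK.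
apply: le_trans (nrmB _ _) _.
by have := state_nrm_le (x - y) s1; have := state_nrm_le (x - y) s2; lra.
Qed.

(** * Maps acting beyond a point *)

(** The endomorphism of the free product given by [act_from k f] fixes what is
    supported on the first [k] copies, and it turns into that of [f] behind the
    shift by [k]: so it isolates the effect of [f] on far copies. *)
Definition act_from (k : nat) (f : nat -> nat) (n : nat) : nat :=
  if (n < k)%N then n else (k + f (n - k))%N.

Lemma act_from_add k f n : act_from k f (k + n) = (k + f n)%N.
Proof. by rewrite /act_from ltnNge leq_addr /= addKn. Qed.

Lemma act_from_lt k f n : (n < k)%N -> act_from k f n = n.
Proof. by rewrite /act_from => ->. Qed.

Lemma act_from_ge k f n : (k <= n)%N -> act_from k f n = (k + f (n - k))%N.
Proof. by rewrite /act_from ltnNge => ->. Qed.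

Definition act_from_closed (G : set (nat -> nat)) : Prop :=
  forall k f, G f -> G (act_from k f).

Lemma cofinite_increasing_act_from : act_from_closed cofinite_increasing.
Proof.
move=> k f [fm fin]; split.
  move=> m n mn; case: (ltnP n k) => nk.
    by rewrite !act_from_lt // (ltn_trans mn).
  rewrite [ltnRHS]act_from_ge //; case: (ltnP m k) => mk.
    by rewrite act_from_lt // ltn_addr.
  by rewrite act_from_ge // ltn_add2l fm // ltn_sub2r // (leq_ltn_trans mk).
apply: (sub_finite_set _ (finite_image (addn k) fin)) => n /= nr.
have kn : (k <= n)%N.
  by rewrite leqNgt; apply/negP => nk; apply: nr; exists n => //; rewrite act_from_lt.
exists (n - k)%N; last by rewrite subnKC.
by move=> [m _ mE]; apply: nr; exists (k + m)%N => //; rewrite act_from_add mE subnKC.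
Qed.

Lemma act_from_comp k f g n : act_from k f (act_from k g n) = act_from k (f \o g) n.
Proof.
case: (ltnP n k) => nk; first by rewrite !act_from_lt.
by rewrite (act_from_ge g nk) act_from_add (act_from_ge _ nk).
Qed.

Lemma finite_permutations_act_from : act_from_closed finite_permutations.
Proof.
move=> k f [[g gf fg] fin]; split.
  exists (act_from k g) => n; rewrite act_from_comp.
    by case: (ltnP n k) => nk; [rewrite act_from_lt | rewrite act_from_ge //= gf subnKC].
  by case: (ltnP n k) => nk; [rewrite act_from_lt | rewrite act_from_ge //= fg subnKC].
apply: (sub_finite_set _ (finite_image (addn k) fin)) => n /= nr.
have kn : (k <= n)%N.
  by rewrite leqNgt; apply/negP => nk; apply: nr; rewrite act_from_lt.
exists (n - k)%N; last by rewrite subnKC.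
by move=> fE; apply: nr; rewrite act_from_ge // fE subnKC.
Qed.

(** Invariance under the partial shifts, which leave a gap at [k].  It is the
    common consequence of spreadability and exchangeability from which weak
    convergence along the shift follows. *)
Definition shift_invariant (psi : F -> R[i]) : Prop :=
  forall k x, psi (fp_endo F (act_from k succn) x) = psi x.

Lemma succn_cofinite_increasing : cofinite_increasing succn.
Proof.
split=> //; apply: (sub_finite_set _ (finite_set1 0%N)) => n nr.
by case: n nr => // n []; exists n.
Qed.

Lemma spreadable_shift_invariant psi : spreadable_states F psi -> shift_invariant psi.
Proof.
move=> [_ inv] k x; apply: inv.
exact/cofinite_increasing_act_from/succn_cofinite_increasing.
Qed.

(** The cycle [k -> k+1 -> ... -> n -> k]. *)
Definition cycle_from (k n i : nat) : nat :=
  if (i < k)%N then i else if (i < n)%N then i.+1 else if i == n then k else i.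

Lemma cycle_from_permutation k n : (k <= n)%N -> finite_permutations (cycle_from k n).
Proof.
move=> kn; split.
  exists (fun i => if (i < k)%N then i else if i == k then n else if (i <= n)%N then i.-1 else i).
    move=> i; rewrite /cycle_from.
    case: (ltnP i k) => ik; first by rewrite ik.
    case: (ltnP i n) => i_n; first by do ![case: ifP]; lia.
    by case: (eqVneq i n) => i_n'; do ![case: ifP]; lia.
  move=> i; rewrite /cycle_from.
  case: (ltnP i k) => ik; first by rewrite ik.
  case: (eqVneq i k) => i_k; first by do ![case: ifP]; lia.
  by case: (leqP i n) => i_n; do ![case: ifP]; lia.
apply: (sub_finite_set _ (finite_II n.+1)) => i /=; rewrite /cycle_from.
by move=> h; rewrite ltnNge; apply/negP => ni; apply: h; do ![case: ifP]; lia.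
Qed.

(** On finitely many copies a partial shift acts as a cycle. *)
Lemma exchangeable_shift_invariant psi : exchangeable_states F psi -> shift_invariant psi.
Proof.
move=> [s inv] k; apply: state_ext => //; first exact: is_state_comp.
move=> n x nx; pose m := maxn k n.
rewrite -[RHS](inv _ (cycle_from_permutation (leq_maxl k n : (k <= m)%N))) /=.
congr (psi _).
apply: nx => j a jn; rewrite !fp_endoE; congr (fp_in _ _ _).
rewrite /act_from /cycle_from; case: ltnP => // kj.
by rewrite (leq_trans jn (leq_maxr k n)) addnS subnKC.
Qed.

Lemma shift_invariant_stationary psi : is_state psi -> shift_invariant psi ->
  stationary_states F psi.
Proof.
move=> s inv; split=> // f -> x; rewrite -(inv 0%N x); congr (psi (fp_endo _ _ _)).
by apply: funext => n; rewrite /act_from ltn0 add0n subn0.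
Qed.

End FreeProduct.

(** * Weak convergence along the shift *)

Section Tail.
Variables (R : realType) (A : cstarType R) (F : freeProduct A) (H : hilbertType R).
Variables (rho : F -> H -> H) (xi : H) (phi : F -> R[i]).
Hypotheses (gns : gns_triple phi rho xi) (sphi : is_state phi).
Hypothesis (shift : shift_invariant phi).

Let hr : representation rho. Proof. by case: gns. Qed.
Let dense : closure (range (rho ^~ xi)) = setT. Proof. by case: gns. Qed.
Let phiE x : hdot (rho x xi) xi = phi x. Proof. by case: gns => _ _ _ ->. Qed.
Let lxi : linear (rho ^~ xi). Proof. exact: rep_linear_arg. Qed.

Lemma gns_unit : hdot xi xi = 1.
Proof. by rewrite -{1}[xi](rep1 hr) phiE; case: sphi. Qed.

Lemma gns_nrm1 : nrm xi = 1.
Proof.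
have := nrm_sq xi; rewrite gns_unit cRe1 => h.
by apply/eqP; rewrite -(eqrXn2 (n := 2)) ?nrm_ge0 // h expr1n.
Qed.

Lemma gns_form x y : hdot (rho x xi) (rho y xi) = phi (star y ** x).
Proof. by rewrite -phiE (repM hr) [RHS](rep_adjoint hr) starK. Qed.

Lemma rep_endo_comp f g h x v : (forall n, f (g n) = h n) ->
  rho (fp_endo F f (fp_endo F g x)) v = rho (fp_endo F h x) v.
Proof.
move=> fg.
apply: (representation_unique (representation_comp (fp_endo F g) (representation_comp (fp_endo F f) hr))
  (representation_comp (fp_endo F h) hr)) => j a.
by rewrite /= !fp_endoE fg.
Qed.

(** [shifted k] is the representation that moves the copies [0, 1, ...] to
    [k, k+1, ...].  It converges weakly because, seen from vectors supported on
    the first [k] copies, invariance under partial shifts makes all of its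
    later members equal. *)
Definition shifted (k : nat) (x : F) : H -> H := rho (fp_endo F (addn k) x).

Lemma shifted_rep k : representation (shifted k).
Proof. exact: representation_comp. Qed.

Lemma shifted0 x v : shifted 0 x v = rho x v.
Proof.
by apply: (representation_unique (shifted_rep 0) hr) => j a; rewrite /shifted fp_endoE.
Qed.

Lemma shifted_invariant f k x y z : (forall w, phi (fp_endo F (act_from k f) w) = phi w) ->
  supported k y -> supported k z ->
  hdot (shifted k (fp_endo F f x) (rho y xi)) (rho z xi) =
  hdot (shifted k x (rho y xi)) (rho z xi).
Proof.
move=> inv sy sz.
rewrite /shifted (rep_endo_comp (h := fun n => k + f n)%N) // -!(repM hr) !gns_form.
have fix_ w : supported k w -> fp_endo F (act_from k f) w = w.
  by move=> sw; apply: (supported_endo sw) => j; exact: act_from_lt.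
rewrite -[RHS]inv !homM !homS (fix_ y) // (fix_ z) //.
rewrite -2!phiE !(repM hr) (rep_endo_comp (h := fun n => k + f n)%N) // => n.
exact: act_from_add.
Qed.

Lemma shifted_stable k m x y z : (k <= m)%N -> supported k y -> supported k z ->
  hdot (shifted m x (rho y xi)) (rho z xi) = hdot (shifted k x (rho y xi)) (rho z xi).
Proof.
move=> /subnK <- sy sz; elim: (m - k)%N => [|d ih] //; rewrite -ih.
rewrite -[RHS](shifted_invariant x (shift (d + k)) (supported_le (leq_addl d k) sy)
  (supported_le (leq_addl d k) sz)).
by rewrite /shifted (rep_endo_comp (h := addn (d.+1 + k))) // => n; rewrite addnS.
Qed.

Lemma supported1 k : supported k (cone : F).
Proof. by move=> p q _; rewrite !hom1. Qed.

Lemma shifted_vacuum k x : hdot (shifted k x xi) xi = phi x.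
Proof.
have := shifted_stable x (leq0n k) (@supported1 0) (@supported1 0).
by rewrite !(rep1 hr) shifted0 phiE.
Qed.

Lemma shifted_isometric k x : nrm (shifted k x xi) = nrm (rho x xi).
Proof.
apply/eqP; rewrite -(eqrXn2 (n := 2)) ?nrm_ge0 //; apply/eqP/complexI.
by rewrite -(rep_sq (shifted_rep k)) -(rep_sq hr) shifted_vacuum phiE.
Qed.

Lemma vacuum_approx v (e : R) : 0 < e ->
  exists n y, supported n y /\ nrm (v - rho y xi) <= e.
Proof.
move=> e0; have e20 : 0 < e / 2 by rewrite divr_gt0.
have [x hx] := dense_approx dense v e20.
have [n [y [ny hy]]] := supported_dense x e20; exists n, y; split=> //.
apply: le_trans (nrm_triangle (rho x xi) _ _) _.
rewrite -(linB lxi); have := rep_nrm_le hr (x - y) xi; rewrite gns_nrm1 mulr1; lra.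
Qed.

(** One choice of finitely supported vectors serves all operators of a
    given norm at once. *)
Lemma matrix_coefficient_approx u v (C e : R) : 0 <= C -> 0 < e -> exists n y z,
  [/\ supported n y, supported n z & forall T : H -> H, linear T ->
    (forall w, nrm (T w) <= C * nrm w) ->
    nrm (hdot (T u) v - hdot (T (rho y xi)) (rho z xi)) <= e].
Proof.
move=> C0 e0; pose K := C * (nrm v + nrm u + 1) + 1.
have K0 : 0 < K by rewrite ltr_wpDl // mulr_ge0 // !addr_ge0 ?nrm_ge0.
pose s := Num.min 1 (e / K); have s0 : 0 < s by rewrite lt_min ltr01 divr_gt0.
have s1 : s <= 1 by rewrite ge_min lexx.
have sK : s * K <= e.
  apply: le_trans (_ : e / K * K <= _); last by rewrite divfK ?gt_eqF.
  by rewrite ler_wpM2r ?(ltW K0) // ge_min lexx orbT.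
have [n [y [ny hy]]] := vacuum_approx u s0; have [m [z [mz hz]]] := vacuum_approx v s0.
exists (maxn n m), y, z; split=> [||T lT hT].
- exact: supported_le (leq_maxl _ _) _ ny.
- exact: supported_le (leq_maxr _ _) _ mz.
set u' := rho y xi in hy *; set v' := rho z xi in hz *.
have -> : hdot (T u) v - hdot (T u') v' = hdot (T (u - u')) v + hdot (T u') (v - v').
  by rewrite (linB lT) hdotBl hdotBr addrA subrK.
apply: le_trans (nrmD _ _) _.
have := cauchy_schwarz (T (u - u')) v; have := cauchy_schwarz (T u') (v - v').
have uu : nrm u' <= nrm u + 1 by have := nrm_le_dist u' u; rewrite nrm_distC; lra.
have h1 : nrm (T (u - u')) * nrm v <= (C * s) * nrm v.
  by rewrite ler_wpM2r ?nrm_ge0 // (le_trans (hT _)) // ler_wpM2l.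
have h2 : nrm (T u') * nrm (v - v') <= (C * (nrm u + 1)) * s.
  by rewrite ler_pM ?nrm_ge0 // (le_trans (hT _)) // ler_wpM2l.
by move: sK; rewrite /K; lra.
Qed.

(** Completeness of the scalars, seen as the line spanned by the unit vector
    [xi]. *)
Lemma cauchy_scalar_converges (a : nat -> R[i]) : cauchy_sequence a -> exists l, converges a l.
Proof.
move=> ca; have [|L hL] := cauchy_converges (a := fun k => a k *: xi).
  move=> e /ca[n hn]; exists n => k m nk nm.
  by rewrite -scalerBl nrmZ gns_nrm1 mulr1 hn.
exists (hdot L xi); apply: (converges_ext (N := 0) _ (converges_hdotl xi hL)) => k _.
by rewrite hdotZl gns_unit mulr1.
Qed.

Definition weak_limit (x : F) (T : H -> H) : Prop :=
  forall u v, converges (fun k => hdot (shifted k x u) v) (hdot (T u) v).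

Lemma weak_limit_unique x T S : weak_limit x T -> weak_limit x S -> T = S.
Proof.
move=> hT hS; apply: funext => u; apply: hdot_inj => v.
by rewrite hdotC [RHS]hdotC (converges_unique (hT u v) (hS u v)).
Qed.

Lemma weak_limit_exists x : exists2 T, bounded_op T & weak_limit x T.
Proof.
have hC := rep_nrm_le (shifted_rep _).
have /choice[B0 hB0] : forall uv : H * H, exists l,
    converges (fun k => hdot (shifted k x uv.1) uv.2) l.
  move=> [u v]; apply: cauchy_scalar_converges => e e0.
  have e20 : 0 < e / 2 by rewrite divr_gt0.
  have [n [y [z [ny nz h]]]] := matrix_coefficient_approx u v (nrm_ge0 x) e20.
  exists n => k m nk nm /=.
  have hk := h _ (rep_linear (shifted_rep k) x) (hC k x).
  have hm := h _ (rep_linear (shifted_rep m) x) (hC m x).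
  rewrite (shifted_stable x nk ny nz) in hk; rewrite (shifted_stable x nm ny nz) nrm_distC in hm.
  by apply: le_trans (nrm_triangle (hdot (shifted n x (rho y xi)) (rho z xi)) _ _) _; lra.
pose B u v := B0 (u, v).
have hB u v : converges (fun k => hdot (shifted k x u) v) (B u v) := hB0 (u, v).
have [||||S bS hS] := sesquilinear_op (j := @idfun H) _ (closure_range_id H) (nrm_ge0 x) (B := B).
- by [].
- move=> v c u u'; apply: (converges_unique (hB _ _)).
  apply: (converges_ext (N := 0) _ (convergesD (convergesM c (hB u v)) (hB u' v))) => k _.
  by rewrite (rep_linear (shifted_rep k)) hdotDl hdotZl.
- move=> u c v v'; apply: (converges_unique (hB _ _)).
  apply: (converges_ext (N := 0) _ (convergesD (convergesM (conjC c) (hB u v)) (hB u v'))) => k _.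
  by rewrite hdotDr hdotZr.
- move=> u v; apply: (converges_le (N := 0) _ (hB u v)) => k _.
  by apply: le_trans (cauchy_schwarz _ _) _; rewrite ler_wpM2r ?nrm_ge0.
have [T bT hT] := adjoint_exists bS; exists T => // u v.
by rewrite (adjoint_pair_sym hT) -[hdot _ _](hS u v).
Qed.

(** * The tail algebra as a commutant *)

Definition late_generators (n : nat) : set (H -> H) :=
  [set T | exists k a, (n <= k)%N /\ T = rho (fp_in F k a)].

Definition tail_commutant : set (H -> H) := [set Y | exists n, commutant (late_generators n) Y].

Lemma tail_algebraE : tail_algebra rho = commutant tail_commutant.
Proof.
apply/seteqP; split=> T.
  move=> hT; have [bT _] := hT 0%N I; split=> // Y [n hY].
  by have [_ h] := hT n I; exact: h.
by move=> [bT h] n _; split=> // Y hY; apply: h; exists n.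
Qed.

Lemma tail_commutant_bounded : tail_commutant `<=` bounded_op (H := H).
Proof. by move=> Y [n []]. Qed.

Lemma tail_commutant_adjoint : adjoint_closed tail_commutant.
Proof.
move=> Y [n hY]; have [|Y' hY' adj] := commutant_adjoint _ hY; last by exists Y' => //; exists n.
move=> _ [k [a [nk ->]]]; exists (rho (fp_in F k (star a))); first by exists k, (star a).
by move=> u v; rewrite homS; exact: rep_adjoint.
Qed.

Lemma weak_limit_tail x T : bounded_op T -> weak_limit x T -> commutant tail_commutant T.
Proof.
move=> bT hT; apply/commutantP; split=> // Y SY v.
have [Y' _ adj] := tail_commutant_adjoint SY; have [n hY] := SY.
apply: hdot_inj => w; rewrite hdotC [RHS]hdotC; congr (conjC _).
rewrite adj; apply: (converges_unique (hT (Y v) w)).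
apply: (converges_ext (N := n) _ (hT v (Y' w))) => k nk; rewrite -adj; congr (hdot _ w).
have /commutantP[bY cY] := hY.
apply: (commutant_representation (shifted_rep k) bY) => j a u.
by rewrite /shifted fp_endoE cY //; exists (k + j)%N, a; split=> //; rewrite (leq_trans nk) ?leq_addr.
Qed.

Let M := commutant tail_commutant.

Lemma tail_expectation_exists : exists E : F -> M, forall x, weak_limit x (val (E x)).
Proof.
have /choice[E hE] : forall x, exists T : M, weak_limit x (val T); last by exists E.
move=> x; have [T bT hT] := weak_limit_exists x.
by have [T' T'E] := vn_element (weak_limit_tail bT hT); exists T'; rewrite T'E.
Qed.

(** * The limit map into the tail algebra *)

Section Expectation.
Variable E : F -> M.
Hypothesis hE : forall x, weak_limit x (val (E x)).

Lemma expectation_linear c x y : val (E (c *: x + y)) = c \*: val (E x) \+ val (E y).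
Proof.
apply: (weak_limit_unique (hE _)) => u v /=; rewrite hdotDl hdotZl.
apply: (converges_ext (N := 0) _ (convergesD (convergesM c (hE x u v)) (hE y u v))) => k _.
by rewrite (rep_linear_arg (shifted_rep k) u c x y : shifted _ _ _ = _) hdotDl hdotZl.
Qed.

Lemma expectation1 : val (E cone) = idfun.
Proof.
apply: (weak_limit_unique (hE _)) => u v /=.
apply: (converges_ext (N := 0) _ (converges_cst (hdot u v))) => k _.
by rewrite (rep1 (shifted_rep k)).
Qed.

Lemma expectation_ge0 x : op_le (cst 0) (val (E (star x ** x))).
Proof.
move=> v; rewrite /= hdot0l; apply: (converges_ge0 _ (hE _ v v)) => k.
by rewrite (rep_sq (shifted_rep k)) lecR sqr_ge0.
Qed.

Lemma expectation_vacuum x : hdot (val (E x) xi) xi = phi x.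
Proof.
apply: (converges_unique (hE x xi xi)).
by apply: (converges_ext (N := 0) _ (converges_cst (phi x))) => k _; rewrite shifted_vacuum.
Qed.

Lemma expectation_invariant f x : (forall k w, phi (fp_endo F (act_from k f) w) = phi w) ->
  E (fp_endo F f x) = E x.
Proof.
move=> inv; apply: val_inj; apply: (weak_limit_unique (hE _)) => u v.
apply: (convergesB0 (hE x u v)) => e e0.
have e20 : 0 < e / 2 by rewrite divr_gt0.
have [n [y [z [ny nz h]]]] := matrix_coefficient_approx u v (nrm_ge0 x) e20.
exists n => k nk; rewrite subr0.
have h1 := h _ (rep_linear (shifted_rep k) x) (rep_nrm_le (shifted_rep k) x).
have hf := representation_comp (fp_endo F f) (shifted_rep k).
have h2 := h _ (rep_linear hf x) (rep_nrm_le hf x).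
rewrite /= (shifted_invariant x (inv k) (supported_le nk ny) (supported_le nk nz)) in h2.
rewrite nrm_distC in h1.
by apply: le_trans (nrm_triangle (hdot (shifted k x (rho y xi)) (rho z xi)) _ _) _; lra.
Qed.

(** The projection onto the closed span of a tail commutes with that tail, hence
    with tail operators, and it fixes [xi]. *)
Lemma tail_vacuum_closure (X : M) n :
  closure (range (fun y => shifted n y xi)) (val X xi).
Proof.
have lj : linear (fun y => shifted n y xi) := rep_linear_arg (shifted_rep n) xi.
have [p [bp cp hp]] := projection_exists lj.
have pxi : p xi = xi.
  apply: (closed_range_inj lj) => //.
  by apply: subset_closure; exists cone => //; rewrite (rep1 (shifted_rep n)).
suff cp' : commutant (late_generators n) p.
  have /commutantP[_ cX] := vn_mem X.
  suff -> : val X xi = p (val X xi) by exact: cp.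
  by rewrite -cX ?pxi //; exists n.
apply/commutantP; split=> // _ [k [a [nk ->]]] v.
have inv b : forall x, exists y, rho (fp_in F k b) (shifted n x xi) = shifted n y xi.
  move=> x; exists (fp_in F (k - n) b ** x).
  by rewrite (repM (shifted_rep n)) {2}/shifted fp_endoE subnKC.
apply: (projection_commute lj (hr.1 _) (T' := rho (fp_in F k (star a)))) => //.
by move=> u w; rewrite homS; exact: rep_adjoint.
Qed.

(** Hence [shifted k x xi] stays as close to [val X xi] as [rho x xi] is: the
    shifts are isometric, and approximating [val X xi] by a far shifted vector
    shows that it is fixed by them. *)
Lemma expectation_approx (X : M) x (e : R) : 0 <= e ->
  nrm (rho x xi - val X xi) <= e -> nrm (val (E x) xi - val X xi) <= e.
Proof.
move=> e0 hx.
have coef k m z : supported m z ->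
    nrm (hdot (shifted k x xi - val X xi) (rho z xi)) <= e * nrm (rho z xi).
  move=> mz; set N := nrm (rho z xi); have N0 : 0 <= N := nrm_ge0 _.
  apply/ler_addgt0Pr => d d0; pose s := d / (2 * (N + 1)).
  have K0 : 0 < 2 * (N + 1) by rewrite mulr_gt0 // ltr_wpDl.
  have s0 : 0 < s by rewrite divr_gt0.
  (* [y] is moved past the support of [z], where further shifts change nothing. *)
  have /closure_nrm/(_ s s0)[_ [y _ <-] hy] := @tail_vacuum_closure X m.
  have -> : hdot (shifted k x xi - val X xi) (rho z xi) =
      hdot (shifted k (x - fp_endo F (addn m) y) xi) (rho z xi) +
      hdot (shifted m y xi - val X xi) (rho z xi).
    have far : hdot (shifted k (fp_endo F (addn m) y) xi) (rho z xi) =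
        hdot (shifted m y xi) (rho z xi).
      have := shifted_stable y (leq_addl k m) (@supported1 m) mz; rewrite !(rep1 hr) => <-.
      by rewrite /shifted (rep_endo_comp (h := addn (k + m))) // => n; rewrite addnA.
    by rewrite (linB (rep_linear_arg (shifted_rep k) xi)) !hdotBl far addrA subrK.
  apply: le_trans (nrmD _ _) _.
  apply: le_trans (lerD (cauchy_schwarz _ _) (cauchy_schwarz _ _)) _.
  rewrite shifted_isometric (linB lxi) -/N -/(shifted m y xi) (nrm_distC _ (val X xi)).
  have h1 : nrm (rho x xi - shifted m y xi) <= e + s.
    by apply: le_trans (nrm_triangle (val X xi) _ _) _; rewrite lerD.
  have h2 : nrm (rho x xi - shifted m y xi) * N <= (e + s) * N by rewrite ler_wpM2r.
  have h3 : nrm (val X xi - shifted m y xi) * N <= s * N by rewrite ler_wpM2r.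
  have h4 : s * (2 * (N + 1)) = d by rewrite divfK // gt_eqF.
  by move: h2 h3 h4; nra.
have hk k : nrm (shifted k x xi - val X xi) <= e.
  apply: approx_nrm_le => // d d0; have [m [z [mz hz]]] := vacuum_approx (shifted k x xi - val X xi) d0.
  by exists (rho z xi) => //; rewrite hdotC nrm_conj; exact: coef mz.
apply: approx_nrm_le => // d d0; set w := _ - _; exists w; last by rewrite subrr nrm0 ltW.
rewrite {1}/w hdotBl.
apply: (@converges_le _ _ (fun k => hdot (shifted k x xi) w - hdot (val X xi) w) _ _ 0).
  move=> k _; rewrite -hdotBl; apply: le_trans (cauchy_schwarz _ _) _.
  by rewrite ler_wpM2r ?nrm_ge0.
exact: (convergesD (hE x xi w) (converges_cst _)).
Qed.

Let phiM := restriction (M := M) (vector_functional xi).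

(** Dominated states are continuous for the seminorm [nrm (val X xi)], in which
    the values of [E] are dense. *)
Lemma dominated_determined (w : M -> R[i]) c : vn_states M w -> 0 <= c ->
  dominated w xi c -> (forall x, w (E x) = phiM (E x)) -> w = phiM.
Proof.
move=> sw c0 dom wE; apply: funext => X; apply/eqP; rewrite -subr_eq0; apply/eqP.
apply: (@nrm_le_eps _ _ (c + 2)) => e e0.
have [x hx] := dense_approx dense (val X xi) e0; rewrite nrm_distC in hx.
have hEx := expectation_approx (ltW e0) hx.
have [D DE] := vn_element (commutantD tail_commutant_bounded (- 1) (vn_mem (E x)) (vn_mem X)).
have DE' v : val D v = val X v - val (E x) v by rewrite DE /= scaleN1r addrC.
have -> : w X - phiM X = w D - phiM D.
  have -> : phiM D = phiM X - phiM (E x) := vn_stateB (vector_state tail_commutant gns_unit) DE'.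
  by rewrite (vn_stateB sw DE') wE opprB addrA subrK.
apply: le_trans (nrmB _ _) _.
have De : nrm (val D xi) <= e by rewrite DE' nrm_distC.
have h1 : nrm (w D) <= (c + 1) * e.
  apply: nrm_le_sq; first by rewrite mulr_ge0 ?addr_ge0 ?(ltW e0).
  apply: le_trans (dominated_cauchy_schwarz tail_commutant_bounded tail_commutant_adjoint sw D dom) _.
  rewrite exprMn ler_pM ?sqr_ge0 //; first by nra.
  by rewrite ler_pXn2r ?nnegrE ?nrm_ge0 ?(ltW e0).
have h2 : nrm (phiM D) <= e.
  by apply: le_trans (cauchy_schwarz _ _) _; rewrite gns_nrm1 mulr1.
by lra.
Qed.

(** Composition with [E] turns states of the tail algebra into invariant states. *)
Lemma extreme_invariant_tail_commutant (G : set (nat -> nat)) :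
  act_from_closed G -> extreme_point (invariant_states F G) phi ->
  extreme_point (normal_states M) phiM.
Proof.
move=> Gact [[_ inv] ext]; split.
  exact: (vector_normal_state tail_commutant_bounded gns_unit).
move=> w1 w2 t [s1 _] [s2 _] t01 phiME.
have inv_state w : vn_states M w -> invariant_states F G (w \o E).
  move=> [lin pos one]; split.
    split=> [c x y|x|] /=; first by rewrite (lin c (E x) (E y)) // expectation_linear.
      exact/pos/expectation_ge0.
    exact/one/expectation1.
  by move=> f Gf x /=; rewrite expectation_invariant // => k y; apply: inv; exact: Gact.
have phiEE x : phi x = phiM (E x) by rewrite -expectation_vacuum.
have [|e1 e2] := ext _ _ t (inv_state _ s1) (inv_state _ s2) t01.
  by apply: funext => x; rewrite phiEE phiME.
have /andP[t0 t1] := t01.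
split.
  apply: (dominated_determined s1 _ (convex_dominated s2 t01 phiME)).
    by rewrite invr_ge0 ltW.
  by move=> x; rewrite -phiEE -e1.
apply: (dominated_determined s2 _
  (convex_dominated s1 (onem_itv t01) (convex_sym phiME))).
  by rewrite invr_ge0 subr_ge0 ltW.
by move=> x; rewrite -phiEE -e2.
Qed.

(** A state below a multiple of [phi] gives a sesquilinear form
    [psi (star y ** x)] that is bounded for the norm of the GNS space; [S] is the
    operator of this form. *)
Lemma radon_nikodym (psi psi' : F -> R[i]) (t : R) : is_state psi -> is_state psi' ->
  0 < t < 1 -> phi = (fun x => t%:C * psi x + (1 - t)%:C * psi' x) ->
  exists S : H -> H, [/\ bounded_op S, positive_op S,
    forall x v, S (rho x v) = rho x (S v) &
    forall x, psi x = hdot (rho x (S xi)) xi].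
Proof.
move=> [lpsi ppsi psi1] [lpsi' ppsi' _] /andP[t0 t1] phiC.
have below x : Re (psi (star x ** x)) <= t^-1 * nrm (rho x xi) ^+ 2.
  rewrite nrm_sq gns_form phiC !ReImE /= !mul0r !subr0.
  have /ge0cP[_ h] := ppsi' x; rewrite mulrDr mulKf ?gt_eqF // lerDl.
  by rewrite !mulr_ge0 // ?invr_ge0 ?subr_ge0 ltW.
pose B x y := psi (star y ** x).
have [||||S bS hS] := sesquilinear_op lxi dense (C := t^-1) _ (B := B).
- by rewrite invr_ge0 ltW.
- by move=> y c x x'; rewrite /B cmulDr cmulZr lpsi.
- by move=> x c y y'; rewrite /B starD starZ cmulDl cmulZl lpsi.
- move=> x y; apply: nrm_le_sq.
    by rewrite !mulr_ge0 ?nrm_ge0 // invr_ge0 ltW.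
  have [_] := functional_cauchy_schwarz lpsi ppsi x y.
  have /ge0cP[_ p1] := ppsi x; have /ge0cP[_ p2] := ppsi y.
  move=> h; apply: le_trans h _; apply: le_trans (ler_pM p2 p1 (below y) (below x)) _.
  by rewrite le_eqVlt; apply/orP; left; apply/eqP; ring.
have pS : positive_op S.
  apply: (dense_positive_op dense bS) => x.
  by rewrite hdotC -hS -(functional_star lpsi ppsi) starM starK; exact: ppsi.
have cS x v : S (rho x v) = rho x (S v).
  apply: (dense_op_eq dense (bounded_op_comp bS (hr.1 x)) (bounded_op_comp (hr.1 x) bS)) => y /=.
  apply: (dense_inj lxi dense) => z; rewrite -[rho x (rho y xi)](repM hr) -hS.
  have := rep_adjoint hr (star x) (rho z xi) (S (rho y xi)); rewrite starK => <-.
  by rewrite -(repM hr) -hS /B starM cmulA.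
exists S; split=> // x.
rewrite -cS (positive_op_hermitian (bounded_linear bS) pS).
by have := hS x cone; rewrite /B star1 cmul1l (rep1 hr).
Qed.

(** The Radon-Nikodym operators of two stationary components of [phi] define normal
    states of the tail algebra; extremality identifies these with the vector state,
    and [E] carries this back to the components. *)
Lemma tail_extreme_stationary_commutant :
  extreme_point (normal_states M) phiM -> extreme_point (stationary_states F) phi.
Proof.
move=> [_ ext]; split; first exact: shift_invariant_stationary.
move=> psi1 psi2 t [s1 inv1] [s2 inv2] t01 phiC.
have [S1 [b1 p1 c1 h1]] := radon_nikodym s1 s2 t01 phiC.
have [S2 [b2 p2 c2 h2]] := radon_nikodym s2 s1 (onem_itv t01) (convex_sym phiC).
pose w (S : H -> H) (X : M) := hdot (val X (S xi)) xi.
have w_state (psi : F -> R[i]) S : is_state psi -> bounded_op S -> positive_op S ->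
    (forall x v, S (rho x v) = rho x (S v)) ->
    (forall x, psi x = hdot (rho x (S xi)) xi) -> vn_states M (w S).
  move=> [_ _ u] bS pS cS hS; split=> [c X Y Z ZE|X X0|X XE]; rewrite /w.
  - by rewrite ZE /= hdotDl hdotZl.
  - have /commutantP[bX cX] := vn_mem X.
    apply: (positive_op_comm bX bS) => //; last exact/positive_opE.
    apply: funext => v /=; apply: cX; exists 0%N; apply/commutantP; split=> //.
    by move=> _ [k [a [_ ->]]] u'; exact: cS.
  - by rewrite XE /= -u hS (rep1 hr).
have sw1 := w_state _ _ s1 b1 p1 c1 h1; have sw2 := w_state _ _ s2 b2 p2 c2 h2.
have mix : t%:C *: S1 xi + (1 - t)%:C *: S2 xi = xi.
  apply: (dense_inj lxi dense) => x; rewrite !hdotE !conjCr.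
  have dual S (psi : F -> R[i]) : bounded_op S -> positive_op S ->
      (forall x v, S (rho x v) = rho x (S v)) ->
      (forall x, psi x = hdot (rho x (S xi)) xi) -> hdot (rho x xi) (S xi) = psi x.
    by move=> bS pS cS ->; rewrite -(positive_op_hermitian (bounded_linear bS) pS) cS.
  by rewrite (dual S1 psi1) // (dual S2 psi2) // phiE phiC.
have phiME : phiM = (fun X => t%:C * w S1 X + (1 - t)%:C * w S2 X).
  apply: funext => X; rewrite /phiM /restriction /vector_functional /w -{1}mix.
  by rewrite (linD (vn_linear X)) !(linZ (vn_linear X)) !hdotE.
have Sb := tail_commutant_bounded.
have [||e1 e2] := ext (w S1) (w S2) t _ _ t01 phiME.
- by split=> //; exact: (convex_normal Sb sw1 sw2 t01 phiME).
- by split=> //; exact: (convex_normal Sb sw2 sw1 (onem_itv t01) (convex_sym phiME)).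
have concl (psi : F -> R[i]) S : (forall f, [set succn] f -> forall x, psi (fp_endo F f x) = psi x) ->
    (forall x, psi x = hdot (rho x (S xi)) xi) -> w S = phiM -> psi = phi.
  move=> inv hS wS; apply: funext => x.
  have inv_k k : psi (fp_endo F (addn k) x) = psi x.
    elim: k => [|k ih].
      by rewrite hS -/(shifted 0 x _) shifted0 -hS.
    rewrite -ih -(inv succn erefl (fp_endo F (addn k) x)) hS [RHS]hS.
    by rewrite (rep_endo_comp (h := addn k.+1)).
  have lim := hE x (S xi) xi; rewrite -[hdot (val _ _) _]/(w S (E x)) wS in lim.
  rewrite -expectation_vacuum; apply: (converges_unique _ lim).
  apply: (converges_ext (N := 0) _ (converges_cst (psi x))) => k _.
  by rewrite -(inv_k k) hS.
by split; [exact: (concl psi1 S1) | exact: (concl psi2 S2)].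
Qed.

End Expectation.

(** * The equivalences *)

Let T := tail_algebra rho.
Let phiT := restriction (M := T) (vector_functional xi).

Lemma extreme_invariant_tail (G : set (nat -> nat)) :
  act_from_closed G -> extreme_point (invariant_states F G) phi ->
  extreme_point (normal_states T) phiT.
Proof.
have [E hE] := tail_expectation_exists.
by rewrite /phiT /T tail_algebraE; exact: extreme_invariant_tail_commutant.
Qed.

Lemma tail_extreme_stationary :
  extreme_point (normal_states T) phiT -> extreme_point (stationary_states F) phi.
Proof.
have [E hE] := tail_expectation_exists.
by rewrite /phiT /T tail_algebraE; exact: tail_extreme_stationary_commutant.
Qed.

Lemma tail_extreme_pure :
  extreme_point (normal_states T) phiT <-> pure_state phiT /\ normal phiT.
Proof.
rewrite /phiT /T tail_algebraE.
exact: (extreme_normal_pure tail_commutant_bounded gns_unit).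
Qed.

Lemma extreme_invariant_equivalences (G : set (nat -> nat)) :
  act_from_closed G -> invariant_states F G phi ->
  (forall psi, invariant_states F G psi -> stationary_states F psi) ->
  [/\ extreme_point (invariant_states F G) phi <-> extreme_point (stationary_states F) phi,
      extreme_point (invariant_states F G) phi <-> extreme_point (normal_states T) phiT
    & extreme_point (normal_states T) phiT <-> (pure_state phiT /\ normal phiT)].
Proof.
move=> Gact Gphi Gst.
have down : extreme_point (stationary_states F) phi -> extreme_point (invariant_states F G) phi.
  by move=> [_ ext]; split=> // psi1 psi2 t /Gst h1 /Gst h2; exact: ext.
split; last exact: tail_extreme_pure.
  by split=> // /(extreme_invariant_tail Gact)/tail_extreme_stationary.
by split=> [/(extreme_invariant_tail Gact)|/tail_extreme_stationary/down].
Qed.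

End Tail.

Theorem corollary4p3 (R : realType) (A : cstarType R) (F : freeProduct A)
    (phi : F -> R[i]) (H : hilbertType R) (rho : F -> H -> H) (xi : H) :
  gns_triple phi rho xi ->
  let T := tail_algebra rho in
  let phiT := restriction (M := T) (vector_functional xi) in
  (spreadable_states F phi ->
    [/\ extreme_point (spreadable_states F) phi <->
          extreme_point (stationary_states F) phi,
        extreme_point (spreadable_states F) phi <->
          extreme_point (normal_states T) phiT
      & extreme_point (normal_states T) phiT <->
          (pure_state phiT /\ normal phiT)]) /\
  (exchangeable_states F phi ->
    [/\ extreme_point (exchangeable_states F) phi <->
          extreme_point (stationary_states F) phi,
        extreme_point (exchangeable_states F) phi <->
          extreme_point (normal_states T) phiT
      & extreme_point (normal_states T) phiT <->
          (pure_state phiT /\ normal phiT)]).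
Proof.
move=> gns T phiT; split=> hphi.
  have shift := spreadable_shift_invariant hphi.
  apply: (extreme_invariant_equivalences gns hphi.1 shift cofinite_increasing_act_from hphi).
  move=> psi hpsi; apply: (shift_invariant_stationary hpsi.1).
  exact: spreadable_shift_invariant.
have shift := exchangeable_shift_invariant hphi.
apply: (extreme_invariant_equivalences gns hphi.1 shift finite_permutations_act_from hphi).
move=> psi hpsi; apply: (shift_invariant_stationary hpsi.1).
exact: exchangeable_shift_invariant.
Qed.
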